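(* Let $f\in\Gamma_0(\mathcal{X})$, $g\in\Gamma_0(\mathcal{K})$ and $A\in\mathcal{B}(\mathcal{X},\mathcal{K})$ satisfy $\mathcal{S}_p:=\operatorname{argmin}_{x\in\mathcal{X}}[f(x)+g(Ax)]\neq\varnothing$ and the qualification condition $0\in\operatorname{sri}(\operatorname{dom}(g)-A\operatorname{dom}(f))$, and let $\mathfrak{u}>0$ be such that $\|\check{A}\|_{\rm op}\le\frac{1}{\mathfrak{u}}$, where $\check{A}:\mathcal{X}\times\mathcal{K}\to\mathcal{K}:(x,y)\mapsto Ax-y$. Suppose also that $\Psi\in\Gamma_0(\mathcal{X})$ is Gâteaux differentiable with Lipschitzian gradient $\nabla\Psi$ over $\mathcal{X}$ and that $\Omega:=\operatorname{argmin}_{x^\star\in\mathcal{S}_p}\Psi(x^\star)\neq\varnothing$. Define $\mathbf{T}_{\rm LAL}:\mathcal{X}\times\mathcal{K}\times\mathcal{K}\to\mathcal{X}\times\mathcal{K}\times\mathcal{K}:(x,y,\nu)\mapsto(x_T,y_T,\nu_T)$ by $$\begin{aligned}x_T&=\operatorname{prox}_f\bigl(x-\mathfrak{u}^2(A^*Ax-A^*y)+\mathfrak{u}A^*\nu\bigr),\\ y_T&=\operatorname{prox}_g\bigl(y-\mathfrak{u}^2(-Ax+y)-\mathfrak{u}\nu\bigr),\\ \nu_T&=\nu-\mathfrak{u}(Ax_T-y_T).\end{aligned}$$ Then $\mathbf{T}_{\rm LAL}$ can be plugged into the hybrid steepest descent method, with any $\alpha\in(0,1)$ and any $(\lambda_{n+1})_{n\in\mathbb{N}}\in\ell_+^2\setminus\ell_+^1$,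 as $$\begin{aligned}(x_{n+1/2},y_{n+1},\nu_{n+1})&=(1-\alpha)(x_n^\star,y_n,\nu_n)+\alpha\mathbf{T}_{\rm LAL}(x_n^\star,y_n,\nu_n),\\ x_{n+1}^\star&=x_{n+1/2}-\lambda_{n+1}\nabla\Psi(x_{n+1/2}),\end{aligned}$$ and, for any $(x_0^\star,y_0,\nu_0)\in\mathcal{X}\times\mathcal{K}\times\mathcal{K}$, this algorithm generates a sequence $(x_n^\star)_{n\in\mathbb{N}}\subset\mathcal{X}$ which satisfies $\lim_{n\to\infty}d_\Omega(x_n^\star)=0$ if $\dim(\mathcal{X}\times\mathcal{K}\times\mathcal{K})<\infty$ and $\operatorname{Fix}(\mathbf{T}_{\rm LAL})$ is bounded.
   Context: $\mathcal{X}$ and $\mathcal{K}$ are real Hilbert spaces; product spaces carry the inner product given by the sum of the componentwise inner products. $\mathcal{B}(\mathcal{X},\mathcal{K})$ is the set of bounded linear operators, $A^*$ is the adjoint of $A$, $\|\cdot\|_{\rm op}$ is the operator norm. $\Gamma_0(\mathcal{X})$ is the set of proper lower semicontinuous convex functions $\mathcal{X}\to(-\infty,\infty]$; $\operatorname{dom}(f)=\{x: f(x)<\infty\}$. For a convex set $C$, $\operatorname{sri}(C)=\{x\in C:\operatorname{cone}(C-x)=\overline{\operatorname{span}}(C-x)\}$ where $\operatorname{cone}(S)=\{\lambda s:\lambda>0,s\in S\}$. $\operatorname{prox}_f(x)=\operatorname{argmin}_{y}\, f(y)+\frac12\|x-y\|^2$. $\operatorname{Fix}(T)=\{z: T(z)=z\}$.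 $d_\Omega(x)=\min_{y\in\Omega}\|x-y\|$. $\ell_+^1$ (resp. $\ell_+^2$) is the set of summable (resp. square-summable) nonnegative real sequences. The hybrid steepest descent method for minimizing a Gâteaux differentiable convex function $\Theta$ over $\operatorname{Fix}(T)$, with $T$ nonexpansive (i.e. $1$-Lipschitz), is the iteration $z_{n+1}=T(z_n)-\lambda_{n+1}\nabla\Theta(T(z_n))$; the displayed algorithm is this iteration for the operator $(1-\alpha)\mathrm{I}+\alpha\mathbf{T}_{\rm LAL}$ ($\mathrm{I}$ the identity) and $\Theta(x,y,\nu)=\Psi(x)$. *)

(* Defs.v *)
From HB Require Import structures.
From mathcomp Require Import all_boot all_order all_algebra.
From mathcomp Require Import all_classical all_reals all_analysis.
From mathcomp Require Import ring.

Set Implicit Arguments.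
Unset Strict Implicit.
Unset Printing Implicit Defensive.

Import Order.TTheory GRing.Theory Num.Theory.
Import numFieldNormedType.Exports.

Local Open Scope classical_set_scope.
Local Open Scope ring_scope.

HB.mixin Record isHilbert (R : realType) X & CompleteNormedModule R X := {
  hdot : X -> X -> R;
  hdotC : forall x y, hdot x y = hdot y x;
  hdotPl : forall z, GRing.linear_for *%R (hdot^~ z);
  hdotxx : forall x, hdot x x = `|x| ^+ 2 }.

#[short(type="hilbertType")]
HB.structure Definition Hilbert (R : realType) :=
  { X of isHilbert R X & CompleteNormedModule R X }.

Section HilbertTheory.
Context {R : realType} {X : hilbertType R}.
Implicit Types x y z : X.

Let hdot_bilinear : bilinear_for *%R *%R (@hdot R X).
Proof.
split=> [z|z a x y]; first exact: hdotPl.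
by rewrite /= !(hdotC z) hdotPl.
Qed.

HB.instance Definition _ := bilinear_isBilinear.Build R X X R *%R *%R
  (@hdot R X) hdot_bilinear.

Let hdot_sym x y : hdot x y = (-1) ^+ false * idfun (hdot y x).
Proof. by rewrite expr0 mul1r hdotC. Qed.

HB.instance Definition _ := isHermitianSesquilinear.Build R X false idfun
  (@hdot R X) hdot_sym.

Let hdot_gt0 x : x != 0 -> 0 < hdot x x.
Proof. by move=> x0; rewrite hdotxx exprn_gt0// normr_gt0. Qed.

HB.instance Definition _ := isDotProduct.Build R X (@hdot R X) hdot_gt0.

Lemma hdot_le x y : hdot x y <= `|x| * `|y|.
Proof.
have [->|x0] := eqVneq x 0; first by rewrite linear0l normr0 mul0r.
have [->|y0] := eqVneq y 0; first by rewrite linear0r normr0 mulr0.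
have xy0 : 0 < `|x| * `|y| by rewrite mulr_gt0 ?normr_gt0.
have := exprn_ge0 2 (normr_ge0 (`|y| *: x - `|x| *: y)).
rewrite -hdotxx linearBl !linearBr !linearZl_LR !linearZr_LR /= !hdotxx.
rewrite (hdotC y x).
have -> : `|y| * (`|y| * `|x| ^+ 2) - `|y| * (`|x| * hdot x y) -
  (`|x| * (`|y| * hdot x y) - `|x| * (`|x| * `|y| ^+ 2)) =
  2 * (`|x| * `|y|) * (`|x| * `|y| - hdot x y) by ring.
by rewrite pmulr_rge0 ?subr_ge0// mulr_gt0.
Qed.

End HilbertTheory.

(* The library norm on X * Y is the maximum of the component norms; hprod X Y
   is an alias whose inner product is the sum of the componentwise ones. *)
Definition hprod (X Y : Type) : Type := (X * Y)%type.

Section HilbertProduct.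
Context {R : realType} {X Y : hilbertType R}.
Local Notation H := (hprod X Y).

HB.instance Definition _ := GRing.Lmodule.copy H (X * Y)%type.

Definition hprod_dot (z w : H) : R := hdot z.1 w.1 + hdot z.2 w.2.

Definition hprod_norm (z : H) : R := Num.sqrt (hprod_dot z z).

Let dotxx_ge0 (z : H) : 0 <= hprod_dot z z.
Proof. by rewrite /hprod_dot !hdotxx addr_ge0// sqr_ge0. Qed.

Let norm_sqr (z : H) : hprod_norm z ^+ 2 = `|z.1| ^+ 2 + `|z.2| ^+ 2.
Proof. by rewrite /hprod_norm sqr_sqrtr// /hprod_dot !hdotxx. Qed.

Let norm_ge0 (z : H) : 0 <= hprod_norm z. Proof. exact: sqrtr_ge0. Qed.

Let dot_le (z w : H) : hprod_dot z w <= hprod_norm z * hprod_norm w.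
Proof.
have [d0|/ltW d0] := leP (hprod_dot z w) 0.
  by apply: (le_trans d0); exact: mulr_ge0.
rewrite -(@ler_pXn2r _ 2)// ?nnegrE ?mulr_ge0// exprMn !norm_sqr.
have h1 := hdot_le z.1 w.1; have h2 := hdot_le z.2 w.2.
have le : hprod_dot z w <= `|z.1| * `|w.1| + `|z.2| * `|w.2| by rewrite lerD.
apply: (@le_trans _ _ ((`|z.1| * `|w.1| + `|z.2| * `|w.2|) ^+ 2)).
  by rewrite ler_pXn2r// ?nnegrE// addr_ge0// mulr_ge0.
rewrite -subr_ge0; have := sqr_ge0 (`|z.1| * `|w.2| - `|z.2| * `|w.1|).
by congr (0 <= _); ring.
Qed.

Let ler_normD (z w : H) : hprod_norm (z + w) <= hprod_norm z + hprod_norm w.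
Proof.
rewrite -(@ler_pXn2r _ 2)// ?nnegrE ?addr_ge0//.
have zw := dot_le z w.
have -> : hprod_norm (z + w) ^+ 2 =
    hprod_norm z ^+ 2 + hprod_norm w ^+ 2 + 2 * hprod_dot z w.
  rewrite !norm_sqr -!hdotxx /hprod_dot /= !linearDl !linearDr /=.
  rewrite (hdotC w.1 z.1) (hdotC w.2 z.2); ring.
have -> : (hprod_norm z + hprod_norm w) ^+ 2 =
    hprod_norm z ^+ 2 + hprod_norm w ^+ 2 + 2 * (hprod_norm z * hprod_norm w).
  by ring.
by rewrite lerD2l ler_pM2l.
Qed.

Let normrZ (l : R) (z : H) : hprod_norm (l *: z) = `|l| * hprod_norm z.
Proof.
apply/eqP; rewrite -(@eqrXn2 _ 2)// ?mulr_ge0// exprMn !norm_sqr.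
by rewrite /= !normrZ !exprMn mulrDr.
Qed.

Let normr0_eq0 (z : H) : hprod_norm z = 0 -> z = 0.
Proof.
move=> z0; have /eqP := norm_sqr z.
rewrite z0 expr0n/= eq_sym paddr_eq0 ?sqr_ge0// !sqrf_eq0 !normr_eq0.
by case: z {z0} => a b /= /andP[/eqP-> /eqP->].
Qed.

HB.instance Definition _ := Lmodule_isNormed.Build R H
  ler_normD normrZ normr0_eq0.

Let normE (z : H) : `|z| = hprod_norm z. Proof. by []. Qed.

Let fst_le (z : H) : `|z.1| <= `|z|.
Proof.
by rewrite -(@ler_pXn2r _ 2)// ?nnegrE// normE norm_sqr lerDl sqr_ge0.
Qed.

Let snd_le (z : H) : `|z.2| <= `|z|.
Proof.
by rewrite -(@ler_pXn2r _ 2)// ?nnegrE// normE norm_sqr lerDr sqr_ge0.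
Qed.

Let norm_le (z : H) : `|z| <= `|z.1| + `|z.2|.
Proof.
rewrite -(@ler_pXn2r _ 2)// ?nnegrE ?addr_ge0// normE norm_sqr sqrrD.
by rewrite -addrA (addrC (_ *+ 2)) addrA lerDl mulrn_wge0// mulr_ge0.
Qed.

Let hprod_complete (F : set_system H) : ProperFilter F -> cauchy F -> cvg F.
Proof.
move=> FF /cauchyP Fc.
have cau (Z : hilbertType R) (p : H -> Z) :
    (forall z w, `|p z - p w| <= `|z - w|) -> cvg (p @ F).
  move=> pl; apply: cauchy_cvg; apply/cauchyP => e e0.
  have [z Fz] := Fc e e0; exists (p z); rewrite -!ball_normE in Fz *.
  apply: (@filterS _ F _ (ball_ Num.norm z e)) Fz => w /=.
  exact: le_lt_trans.
have c1 := cau X fst (fun z w => fst_le (z - w)).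
have c2 := cau Y snd (fun z w => snd_le (z - w)).
apply/cvg_ex; exists ((lim ((fst : H -> X) @ F), lim ((snd : H -> Y) @ F)) : H).
apply/cvgrPdist_lt => e e0; near=> z.
apply: le_lt_trans (norm_le _) _; rewrite (splitr e) /=; apply: ltrD.
- near: z; apply: (@cvgr_dist_lt _ _ _ _ _ (fst : H -> X)) => //.
  by rewrite divr_gt0.
- near: z; apply: (@cvgr_dist_lt _ _ _ _ _ (snd : H -> Y)) => //.
  by rewrite divr_gt0.
Unshelve. all: by end_near. Qed.

HB.instance Definition _ := Uniform_isComplete.Build H hprod_complete.

Let hprod_dotC (z w : H) : hprod_dot z w = hprod_dot w z.
Proof. by rewrite /hprod_dot !(hdotC z.1) !(hdotC z.2). Qed.

Let hprod_dotPl (w : H) : GRing.linear_for *%R (hprod_dot^~ w).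
Proof.
by move=> a z z'; rewrite /hprod_dot /= !linearPl mulrDr addrACA.
Qed.

Let hprod_dotxx (z : H) : hprod_dot z z = `|z| ^+ 2.
Proof. by rewrite normE sqr_sqrtr. Qed.

HB.instance Definition _ := isHilbert.Build R H
  hprod_dotC hprod_dotPl hprod_dotxx.

End HilbertProduct.

Section ConvexAnalysis.
Context {R : realType}.
Implicit Types X K : hilbertType R.

Definition dom X (f : X -> \bar R) : set X := [set x | (f x < +oo)%E].

Definition convex_efun X (f : X -> \bar R) : Prop :=
  forall (x y : X) (t : R), 0 < t < 1 ->
    (f (t *: x + (1 - t) *: y)%R <= t%:E * f x + (1 - t)%:E * f y)%E.

Definition Gamma0 X (f : X -> \bar R) : Prop :=
  [/\ forall x, (-oo < f x)%E, dom f !=set0,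
      lower_semicontinuous f & convex_efun f].

Definition argmin X (C : set X) (F : X -> \bar R) : set X :=
  [set x | C x /\ forall y, C y -> (F x <= F y)%E].

(* The minimizer exists and is unique for f in Gamma0; 0 is a junk value. *)
Definition prox X (f : X -> \bar R) (x : X) : X :=
  xget 0 (argmin setT (fun y => f y + (2^-1 * `|x - y| ^+ 2)%:E)%E).

Definition cone X (S : set X) : set X :=
  [set v | exists (l : R) (s : X), [/\ 0 < l, S s & v = l *: s]].

Definition span X (S : set X) : set X :=
  [set v | exists (n : nat) (a : 'I_n -> R) (s : 'I_n -> X),
    (forall i, S (s i)) /\ v = \sum_(i < n) a i *: s i].

Definition sri X (C : set X) : set X :=
  [set x | C x /\
    cone [set c - x | c in C] = closure (span [set c - x | c in C])].

Definition finite_dim X : Prop := exists s : seq X, span [set` s] = setT.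

(* For bounded linear L; sup is 0 on unbounded sets. *)
Definition opnorm X K (L : X -> K) : R :=
  sup [set `|L x| | x in [set x | `|x| <= 1]].

(* The Riesz representative: it exists and is unique for bounded linear A. *)
Definition adjoint X K (A : X -> K) (y : K) : X :=
  xget 0 [set z | forall x, hdot (A x) y = hdot x z].

Definition is_gradient X (Psi : X -> R) (x u : X) : Prop :=
  forall h : X, is_derive x h Psi (hdot h u).

Definition gateaux_differentiable X (Psi : X -> R) : Prop :=
  forall x, exists u, is_gradient Psi x u.

(* Unique when it exists, the derivative along every h being fixed. *)
Definition gradient X (Psi : X -> R) (x : X) : X := xget 0 (is_gradient Psi x).

Definition Fix X (T : X -> X) : set X := [set z | T z = z].

(* The infimum is attained, hence a minimum, for C nonempty closed convex. *)
Definition dist X (C : set X) (x : X) : R := inf [set `|x - y| | y in C].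

Definition ell_plus (p : nat) : set (nat -> R) :=
  [set u : nat -> R | (forall n, 0 <= u n) /\ cvgn (series (fun n => u n ^+ p))].

(* Requirements and iteration of the hybrid steepest descent method for
   minimizing Theta over Fix T. *)
Definition hsdm_applicable X (T : X -> X) (Theta : X -> R) : Prop :=
  [/\ 1.-lipschitz T, convex_efun (EFin \o Theta) &
      gateaux_differentiable Theta].

Definition hsdm_iteration X (T : X -> X) (Theta : X -> R) (lambda : nat -> R)
    (z : nat -> X) : Prop :=
  forall n, z n.+1 = T (z n) - lambda n.+1 *: gradient Theta (T (z n)).

Definition relax X (alpha : R) (T : X -> X) (z : X) : X :=
  (1 - alpha) *: z + alpha *: T z.

Definition T_LAL X K (f : X -> \bar R) (g : K -> \bar R) (A : X -> K) (u : R)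
    (z : hprod X (hprod K K)) : hprod X (hprod K K) :=
  let: (x, (y, nu)) := z in
  let xT := prox f (x - u ^+ 2 *: (adjoint A (A x) - adjoint A y)
                    + u *: adjoint A nu) in
  let yT := prox g (y - u ^+ 2 *: (- A x + y) - u *: nu) in
  let nuT := nu - u *: (A xT - yT) in
  (xT, (yT, nuT)).

End ConvexAnalysis.

(* Main.v *)
Require Import Defs.
From HB Require Import structures.
From mathcomp Require Import all_boot all_order all_algebra.
From mathcomp Require Import all_classical all_reals all_analysis.
From mathcomp Require Import ring lra.
Set Implicit Arguments.
Unset Strict Implicit.
Unset Printing Implicit Defensive.
Import Order.TTheory GRing.Theory Num.Theory.
Import numFieldNormedType.Exports.
Local Open Scope classical_set_scope.
Local Open Scope ring_scope.

(** The operator [T_LAL] is a preconditioned proximal point step. Put [w = (x, y)],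
[F w = f x + g y] and [B = u (A, - I)], so that [B] has norm at most one. One
application maps [(w, nu)] to the point [(w', nu - B w')], where
[w - B^* B w + B^* nu - w'] is a subgradient of [F] at [w']. Monotonicity of the
subdifferential and [|B| <= 1] then show that [T_LAL] is nonexpansive
([LAL_energy], [LAL_nonexpansive]), and so are its relaxations. This part holds in
every Hilbert space; it needs proximity operators to be total ([prox_exists], by
minimizing sequences) and adjoints to exist ([adjointP], from the Riesz
representation, itself the optimality condition of a proximal point).

A point [(x, (y, nu))] is fixed by [T_LAL] exactly when [y = A x],
[u A^* nu \in df(x)] and [- u nu \in dg(A x)] ([fixed_LAL]); then [x] solves the primal
problem. Conversely each primal solution is the first component of a fixed point:
the qualification condition says that the perturbations [t (y - A x)] form a linear
subspace, on which the excess cost is sublinear, and a Hahn-Banach extension along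
the vectors of a finite frame yields the multiplier ([cost_cone_multiplier],
[multiplier_exists]). Finite dimension is available because the convergence claim
assumes it. Hence minimizing [Psi x] over the fixed points of [T_LAL] amounts to
minimizing [Psi] over the primal solutions, and the distance from [x] to [Omega] is at
most the distance from [(x, (y, nu))] to the minimizers of [Theta] over [Fix T].

It remains to prove the convergence of the hybrid steepest descent method in finite
dimension ([hsdm_dist_cvg0]). The residual [z - T z] has an inner product with [z - p],
for a fixed point [p], that grows linearly far from [p], because the fixed-point set is
bounded ([residual_growth]); this dominates the first-order error of the gradient
step, and the second-order errors are summable, so the iterates stay bounded
([iterates_bounded]). On a bounded set, points at distance at least [delta] from the
solutions either have a residual bounded below or exceed the optimal value by a
fixed amount ([optimality_gap]). In both cases the squared distance to the solution set
decreases by at least a multiple of the step size, and as the steps tend to zero with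
a divergent sum the distance must tend to zero ([divergent_descent_cvg0]). *)

(** * Inner products *)

Section InnerProduct.
Context {R : realType} {X : hilbertType R}.
Implicit Types x y z : X.

Lemma hdotDl x y z : hdot (x + y) z = hdot x z + hdot y z.
Proof. exact: linearDl. Qed.

Lemma hdotDr x y z : hdot x (y + z) = hdot x y + hdot x z.
Proof. exact: linearDr. Qed.

Lemma hdotBl x y z : hdot (x - y) z = hdot x z - hdot y z.
Proof. exact: linearBl. Qed.

Lemma hdotBr x y z : hdot x (y - z) = hdot x y - hdot x z.
Proof. exact: linearBr. Qed.

Lemma hdotNl x y : hdot (- x) y = - hdot x y.
Proof. exact: linearNl. Qed.

Lemma hdotNr x y : hdot x (- y) = - hdot x y.
Proof. exact: linearNr. Qed.

Lemma hdotZl a x y : hdot (a *: x) y = a * hdot x y.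
Proof. exact: linearZl_LR. Qed.

Lemma hdotZr a x y : hdot x (a *: y) = a * hdot x y.
Proof. exact: linearZr_LR. Qed.

Lemma hdot0l x : hdot 0 x = 0.
Proof. exact: linear0l. Qed.

Lemma hdot0r x : hdot x 0 = 0.
Proof. exact: linear0r. Qed.

Definition hdotE := (hdotDl, hdotDr, hdotBl, hdotBr, hdotNl, hdotNr, hdotZl,
  hdotZr, hdot0l, hdot0r).

Lemma sqnormE x : `|x| ^+ 2 = hdot x x.
Proof. by rewrite hdotxx. Qed.

Lemma hdotxx_ge0 x : 0 <= hdot x x.
Proof. by rewrite hdotxx sqr_ge0. Qed.

Lemma hdot_ge x y : - (`|x| * `|y|) <= hdot x y.
Proof. by rewrite lerNl -hdotNl (le_trans (hdot_le _ _))// normrN. Qed.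

Lemma hdot_eq0P x : (forall h, hdot h x = 0) -> x = 0.
Proof.
by move=> /(_ x); rewrite hdotxx => /eqP; rewrite sqrf_eq0 normr_eq0 => /eqP.
Qed.

Lemma hdot_inj x y : (forall h, hdot h x = hdot h y) -> x = y.
Proof.
by move=> xy; apply/subr0_eq/hdot_eq0P => h; rewrite hdotBr xy subrr.
Qed.

Lemma sqnorm_le x y : hdot x x <= hdot y y -> `|x| <= `|y|.
Proof. by rewrite !hdotxx ler_pXn2r ?nnegrE. Qed.

End InnerProduct.

(** * Subgradients and proximity operators *)

Section Proximity.
Context {R : realType} {X : hilbertType R}.
Implicit Types (f : X -> \bar R) (x y p v : X).

Definition subgradient f p v : Prop :=
  forall y, (f p + (hdot v (y - p))%:E <= f y)%E.

Lemma Gamma0_fin f x : Gamma0 f -> dom f x -> f x = (fine (f x))%:E.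
Proof.
by move=> [fNy _ _ _] fx; rewrite fineK// fin_numE gt_eqF ?lt_eqF//= ?fNy.
Qed.

Lemma subgradient_dom f p v : Gamma0 f -> subgradient f p v -> dom f p.
Proof.
move=> [fNy [x fx] _ _] /(_ x); rewrite /dom /= in fx *.
have := fNy p; case: (f p) => [r _ _|_|//]; first by rewrite ltry.
by rewrite addye// leye_eq => /eqP fxy; rewrite fxy ltxx in fx.
Qed.

Lemma subgradient_le f p v y : Gamma0 f -> subgradient f p v -> dom f y ->
  fine (f p) + hdot v (y - p) <= fine (f y).
Proof.
move=> fG pv fy; have fp := subgradient_dom fG pv.
by have := pv y; rewrite (Gamma0_fin fG fp) (Gamma0_fin fG fy).
Qed.

Lemma subgradient_monotone f p q v w : Gamma0 f ->
  subgradient f p v -> subgradient f q w -> 0 <= hdot (v - w) (p - q).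
Proof.
move=> fG pv qw.
have := subgradient_le fG pv (subgradient_dom fG qw).
have := subgradient_le fG qw (subgradient_dom fG pv).
rewrite !hdotE; lra.
Qed.

Lemma Gamma0_convex f x y t : Gamma0 f -> dom f x -> dom f y -> 0 < t < 1 ->
  dom f (t *: x + (1 - t) *: y) /\
  fine (f (t *: x + (1 - t) *: y)) <= t * fine (f x) + (1 - t) * fine (f y).
Proof.
move=> fG fx fy t01; have [_ _ _ /(_ x y t t01)] := fG.
rewrite (Gamma0_fin fG fx) (Gamma0_fin fG fy) -!EFinM -EFinD => le.
have fd : dom f (t *: x + (1 - t) *: y) by apply: le_lt_trans le _; rewrite ltry.
by split => //; move: le; rewrite (Gamma0_fin fG fd) lee_fin.
Qed.

(** Lower semicontinuity bounds the function below near one point of its domain,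
and convexity propagates that bound along rays at a linear rate. Such a conical
minorant is enough to bound below the objective that defines the proximity
operator, and it is obtained without separating convex sets. *)
Lemma Gamma0_minorant f : Gamma0 f -> exists (x0 : X) (a d : R), 0 < d /\
  forall y, dom f y -> a - d * `|y - x0| <= fine (f y).
Proof.
move=> fG; have [_ [x0 fx0] flsc _] := fG.
have [|V Vx0 fV] := flsc x0 (fine (f x0) - 1).
  by rewrite (Gamma0_fin fG fx0) lte_fin/= ltrBlDr ltrDl.
have /nbhs_ballP[e /= e0 eV] := Vx0.
exists x0, (fine (f x0) - 1), (2 / e); split; first by rewrite divr_gt0.
move=> y fy; have [ylt|yge] := ltP `|y - x0| e.
  have /fV : V y by apply: eV; rewrite -ball_normE /= distrC.
  rewrite (Gamma0_fin fG fy) lte_fin => lt.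
  have : 0 <= 2 / e * `|y - x0| by rewrite mulr_ge0// divr_ge0// ltW.
  lra.
have s0 : 0 < `|y - x0| by apply: lt_le_trans yge.
pose t := e / (2 * `|y - x0|).
have t01 : 0 < t < 1.
  by rewrite divr_gt0 ?mulr_gt0//= ltr_pdivrMr ?mulr_gt0//; lra.
have [fp cvx] := Gamma0_convex fG fy fx0 t01.
have /fV : V (t *: y + (1 - t) *: x0).
  apply: eV; rewrite -ball_normE /= distrC.
  have -> : t *: y + (1 - t) *: x0 - x0 = t *: (y - x0).
    by rewrite scalerBl scale1r scalerBr addrA addrAC addrK.
  rewrite normrZ gtr0_norm; last by case/andP: t01.
  have -> : t * `|y - x0| = e / 2 by rewrite /t; field; rewrite gt_eqF.
  lra.
rewrite (Gamma0_fin fG fp) lte_fin => lt.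
have tE : t * (2 / e * `|y - x0|) = 1.
  by rewrite /t; field; rewrite !gt_eqF.
have : 0 < t * (fine (f y) - fine (f x0) + 2 / e * `|y - x0|).
  by rewrite !mulrDr tE; lra.
by rewrite pmulr_rgt0; [lra|case/andP: t01].
Qed.

(** Midpoint convexity makes any minimizing sequence of the strongly convex
objective a Cauchy sequence; completeness gives its limit and lower
semicontinuity makes that limit a minimizer. *)
Lemma prox_exists f x : Gamma0 f ->
  argmin setT (fun y => f y + (2^-1 * `|x - y| ^+ 2)%:E)%E !=set0.
Proof.
move=> fG; have [fNy [y0 fy0] flsc _] := fG.
pose F y := fine (f y) + 2^-1 * `|x - y| ^+ 2.
pose I := [set F y | y in dom f].
have [x0 [a [d [d0 fd]]]] := Gamma0_minorant fG.
have Ilb : lbound I (a - d * `|x - x0| - d ^+ 2 / 2).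
  move=> _ [y fy <-]; have := fd y fy.
  have : `|y - x0| <= `|x - y| + `|x - x0|.
    by rewrite (distrC x y) (le_trans _ (ler_normD _ _))// addrA subrK.
  rewrite /F -(ler_pM2l d0) => h1 h2.
  have := sqr_ge0 (`|x - y| - d); nra.
have Ih : has_inf I by split; [exists (F y0), y0|exists (a - d * `|x - x0| - d ^+ 2 / 2)].
have Ile y : dom f y -> inf I <= F y by move=> fy; apply: ge_inf; [exact: Ih.2|exists y].
have mid y z : dom f y -> dom f z ->
    `|y - z| ^+ 2 <= 4 * (F y + F z - 2 * inf I).
  move=> fy fz; have h01 : 0 < (2^-1 : R) < 1 by lra.
  have [fm] := Gamma0_convex fG fy fz h01.
  have := Ile _ fm; rewrite /F.
  have -> : `|x - (2^-1 *: y + (1 - 2^-1) *: z)| ^+ 2 =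
      2^-1 * `|x - y| ^+ 2 + 2^-1 * `|x - z| ^+ 2 - 4^-1 * `|y - z| ^+ 2.
    rewrite !sqnormE !hdotE (hdotC y x) (hdotC z x) (hdotC z y); lra.
  lra.
have /choice[s sP] : forall n : nat, exists y, dom f y /\ F y < inf I + n.+1%:R^-1.
  move=> n; have n0 : 0 < n.+1%:R^-1 :> R by rewrite invr_gt0.
  have [r Ir rn] := inf_adherent n0 Ih; case: Ir => y fy yr.
  by exists y; rewrite yr.
have scau : cvg (s @ \oo).
  apply: cauchy_cvg; apply: cauchy_exP => e e0.
  have e8 : 0 < e ^+ 2 / 8 by rewrite divr_gt0 ?exprn_gt0.
  have [N _ NP] := near_infty_natSinv_lt (PosNum e8).
  exists (s N); exists N => // n /= Nn; rewrite -ball_normE /=.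
  rewrite -(@ltr_pXn2r _ 2)// ?nnegrE ?(ltW e0)//.
  have [fN FN] := sP N; have [fn Fn] := sP n.
  apply: le_lt_trans (mid _ _ fN fn) _.
  have /= := NP N (leqnn N); have /= := NP n Nn.
  by move: FN Fn; move: (F (s N)) (F (s n)) (N.+1%:R^-1) (n.+1%:R^-1) => ? ? ? ?; lra.
pose p := lim (s @ \oo); exists p; split=> // y _.
suff pm : (f p <= (inf I - 2^-1 * `|x - p| ^+ 2)%:E)%E.
  have [fy|] := boolP (f y < +oo)%E; last first.
    by rewrite ltey negbK => /eqP ->; rewrite addye// leey.
  apply: (@le_trans _ _ (inf I)%:E).
    by rewrite -[leRHS](@subeK _ _ (2^-1 * `|x - p| ^+ 2)%:E)// leeD2r// -EFinB.
  by rewrite (Gamma0_fin fG fy) -EFinD lee_fin; apply: Ile.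
apply/lee_addgt0Pr => e e0; rewrite leNgt; apply/negP => lt.
have [V /= Vp fV] := flsc p _ lt.
have nc : (fun n => 2^-1 * `|x - s n| ^+ 2) @ \oo --> 2^-1 * `|x - p| ^+ 2.
  apply: cvgMr; rewrite expr2; under eq_cvg do rewrite expr2.
  by apply: cvgM; apply: cvg_norm; apply: cvgB => //; exact: cvg_cst.
have e2 : 0 < e / 2 by rewrite divr_gt0.
move: nc => /cvgrPdist_lt/(_ _ e2) nc.
near \oo => n.
have [fn Fn] := sP n.
have /fV : V (s n) by near: n; exact: scau.
rewrite (Gamma0_fin fG fn) lte_fin.
have : n.+1%:R^-1 < e / 2 by near: n; exact: (near_infty_natSinv_lt (PosNum e2)).
have : `|2^-1 * `|x - p| ^+ 2 - 2^-1 * `|x - s n| ^+ 2| < e / 2.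
  by near: n; exact: nc.
rewrite ltr_norml => /andP[_].
by move: Fn; rewrite /F; move: n.+1%:R^-1 => ?; lra.
Unshelve. all: by end_near. Qed.

(** Together with [subgradient_prox] this is the resolvent description of the
proximity operator, [x - prox f x \in df(prox f x)]; every later property of
[prox] is derived from it. *)
Lemma prox_subgradient f x : Gamma0 f -> subgradient f (prox f x) (x - prox f x).
Proof.
move=> fG; rewrite /prox; case: xgetP => [p _ [_ pmin]|none]; last first.
  by have [p pP] := prox_exists x fG; case: (none p).
have [fNy [y0 fy0] _ _] := fG.
have fp : dom f p.
  have := pmin y0 I; rewrite (Gamma0_fin fG fy0) -EFinD /dom /=.
  have := fNy p; case: (f p) => [r _ _|_|//]; first by rewrite ltry.
  by rewrite addye// leye_eq.
move=> y; have [fy|] := boolP (f y < +oo)%E; last first.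
  by rewrite ltey negbK => /eqP ->; rewrite leey.
rewrite (Gamma0_fin fG fp) (Gamma0_fin fG fy) -EFinD lee_fin.
(* Compare the objective at p with its value at p + t (y - p) and let t -> 0. *)
have H t : 0 < t < 1 -> fine (f p) + hdot (x - p) (y - p) - fine (f y) <=
    t * (2^-1 * `|y - p| ^+ 2).
  move=> t01; have [fq cvx] := Gamma0_convex fG fy fp t01.
  have := pmin (t *: y + (1 - t) *: p) I.
  rewrite (Gamma0_fin fG fp) (Gamma0_fin fG fq) -!EFinD lee_fin.
  have -> : `|x - (t *: y + (1 - t) *: p)| ^+ 2 = `|x - p| ^+ 2
      - 2 * t * hdot (x - p) (y - p) + t ^+ 2 * `|y - p| ^+ 2.
    rewrite !sqnormE !hdotE (hdotC y x) (hdotC p x) (hdotC p y); ring.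
  have /andP[t0 _] := t01; move=> le.
  by rewrite -(ler_pM2l t0); lra.
rewrite -subr_le0; apply/ler_addgt0Pr => e e0; rewrite add0r.
pose B := 2^-1 * `|y - p| ^+ 2; have B0 : 0 <= B by rewrite mulr_ge0.
have eB0 : 0 < e + B + 1 by lra.
apply: le_trans (H (e / (e + B + 1)) _) _.
  by rewrite divr_gt0//= ltr_pdivrMr// mul1r; lra.
by rewrite -/B mulrAC ler_pdivrMr// ler_pM2l//; lra.
Qed.

(** Monotonicity of the subdifferential makes the resolvent single-valued. *)
Lemma subgradient_prox f x p : Gamma0 f -> subgradient f p (x - p) ->
  prox f x = p.
Proof.
move=> fG fp; have fq := prox_subgradient x fG; set q := prox f x in fq *.
have := subgradient_monotone fG fq fp.
move=> mono; have le0 : `|q - p| ^+ 2 <= 0.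
  by move: mono; rewrite sqnormE !hdotE (hdotC p q); lra.
by apply/eqP; rewrite -subr_eq0 -normr_eq0 -sqrf_eq0 eq_le le0 sqr_ge0.
Qed.

End Proximity.

(** * Bounded operators, adjoints and operator norms *)

Lemma lipschitz_le_continuous (R : realType) (V W : normedModType R)
    (h : V -> W) (k : R) :
  (forall x y, `|h x - h y| <= k * `|x - y|) -> continuous h.
Proof.
move=> hk x; apply/cvgrPdist_lt => e e0; near=> y.
apply: le_lt_trans (hk x y) _.
have k0 : 0 < `|k| + 1 by rewrite ltr_wpDl.
apply: (@le_lt_trans _ _ ((`|k| + 1) * `|x - y|)).
  by rewrite ler_wpM2r// (le_trans (ler_norm k))// lerDl.
rewrite mulrC -ltr_pdivlMr//; near: y.
by apply: (@cvgr_dist_lt _ _ _ (nbhs x)); [exact: cvg_id|rewrite divr_gt0].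
Unshelve. all: by end_near. Qed.

Lemma hdot_continuous (R : realType) (X : hilbertType R) (y : X) :
  continuous (fun x : X => hdot x y).
Proof.
apply: (@lipschitz_le_continuous _ _ _ _ `|y|) => x x'.
by rewrite -hdotBl mulrC ler_norml hdot_ge hdot_le.
Qed.

Lemma continuous_lsc (R : realType) (X : topologicalType) (h : X -> R) :
  continuous h -> lower_semicontinuous (EFin \o h).
Proof.
move=> hc x a; rewrite lte_fin => ax; exists [set y | a < h y].
  exact: (cvgr_gt (h x) (hc x)).
by move=> y; rewrite /= lte_fin.
Qed.

(** The representative is the proximal point of [- phi] at the origin: its
optimality condition reads [phi h <= hdot h p] for every direction [h], and
replacing [h] by [- h] gives equality. *)
Lemma riesz_representation (R : realType) (X : hilbertType R) (phi : X -> R) :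
  (forall a x y, phi (a *: x + y) = a * phi x + phi y) -> continuous phi ->
  exists p, forall x, phi x = hdot x p.
Proof.
move=> phiL phic; pose f := EFin \o (fun x => - phi x).
have phi0 : phi 0 = 0.
  by have := phiL 1 0 0; rewrite scaler0 addr0 mul1r; lra.
have phiZ a x : phi (a *: x) = a * phi x.
  by have := phiL a x 0; rewrite phi0 !addr0.
have phiD x y : phi (x + y) = phi x + phi y.
  by have := phiL 1 x y; rewrite scale1r mul1r.
have fG : Gamma0 f.
  split; first by move=> x; rewrite ltNyr.
  - by exists 0; rewrite /dom /= ltry.
  - by apply: continuous_lsc => x; apply: cvgN; exact: phic.
  - by move=> x y t _; rewrite /f /= -!EFinM -EFinD lee_fin phiD !phiZ; lra.
have fp := prox_subgradient 0 fG; set p := prox f 0 in fp.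
have le h : phi h <= hdot h p.
  have := fp (h + p); rewrite /f /= -EFinD lee_fin addrK sub0r hdotNl phiD.
  by rewrite (hdotC p); lra.
exists p => x; have := le x; have := le (- x).
rewrite hdotNl -scaleN1r phiZ; lra.
Qed.

Section Operators.
Context {R : realType} {X K : hilbertType R}.

Lemma continuous_linear_le (A : {linear X -> K}) : continuous A ->
  exists2 M, 0 < M & forall x, `|A x| <= M * `|x|.
Proof.
move=> /(_ 0)/continuous_linear_bounded/linear_boundedP[M [Mr MP]].
exists (`|M| + 1); first by rewrite ltr_wpDl.
by apply: MP; rewrite ltr_pwDr// ler_norm.
Qed.

Lemma adjointP (A : {linear X -> K}) x y : continuous A ->
  hdot (A x) y = hdot x (adjoint A y).
Proof.
move=> Ac; rewrite /adjoint; case: xgetP => [z _ -> //|none].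
have [|x1|p pP] := @riesz_representation _ _ (fun x => hdot (A x) y).
- by move=> a x1 x2; rewrite linearP hdotDl hdotZl.
- by apply: (@continuous_comp _ _ _ A (fun v => hdot v y) x1);
    [exact: Ac|exact: hdot_continuous].
- by case: (none p).
Qed.

Lemma opnorm_ge (L : X -> K) (M : R) : (forall a x, L (a *: x) = a *: L x) ->
  (forall x, `|L x| <= M * `|x|) -> forall x, `|L x| <= opnorm L * `|x|.
Proof.
move=> LZ LM x; have [->|x0] := eqVneq x 0.
  by rewrite -(scale0r 0) LZ !scale0r !normr0 mulr0.
have n0 : 0 < `|x| by rewrite normr_gt0.
have M0 : 0 <= M by rewrite -(pmulr_lge0 _ n0) (le_trans _ (LM x)).
rewrite -ler_pdivrMr//; apply: ub_le_sup.
  exists M => _ [y /= y1 <-]; rewrite (le_trans (LM y))//.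
  by rewrite ler_piMr.
exists (`|x|^-1 *: x) => /=; last by rewrite LZ normrZ normfV normr_id mulrC.
by rewrite normrZ normfV normr_id mulVf ?gt_eqF.
Qed.

End Operators.

(** * The linearized augmented Lagrangian operator *)

Section Products.
Context {R : realType} {Y Z : hilbertType R}.
Implicit Types z w : hprod Y Z.

Lemma hprod_hdotE z w : hdot z w = hdot z.1 w.1 + hdot z.2 w.2.
Proof. by []. Qed.

Lemma hprod_sqnormE z : `|z| ^+ 2 = `|z.1| ^+ 2 + `|z.2| ^+ 2.
Proof. by rewrite !sqnormE. Qed.

Lemma hprod_norm_fst z : `|z.1| <= `|z|.
Proof. by rewrite -(@ler_pXn2r _ 2)// ?nnegrE// hprod_sqnormE lerDl sqr_ge0. Qed.

Lemma hprod_norm_snd z : `|z.2| <= `|z|.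
Proof. by rewrite -(@ler_pXn2r _ 2)// ?nnegrE// hprod_sqnormE lerDr sqr_ge0. Qed.

End Products.

Section LAL.
Context {R : realType} {X K : hilbertType R}.
Variables (f : X -> \bar R) (g : K -> \bar R) (A : {linear X -> K}) (u : R).
Hypotheses (fG : Gamma0 f) (gG : Gamma0 g) (Ac : continuous A) (u0 : 0 < u).
Let H := hprod X (hprod K K).
Let T : H -> H := T_LAL f g A u.

(** This is [|u (A a - b)| <= |(a, b)|], squared and written with inner products,
the form in which [LAL_energy] consumes it. *)
Lemma coupling_contraction :
  opnorm (fun z : hprod X K => A z.1 - z.2) <= u^-1 ->
  forall (a : X) (b : K),
    u ^+ 2 * hdot (A a - b) (A a - b) <= hdot a a + hdot b b.
Proof.
move=> opA a b; have [M M0 AM] := continuous_linear_le Ac.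
pose L (z : hprod X K) := A z.1 - z.2.
have LZ c z : L (c *: z) = c *: L z by rewrite /L /= linearZ scalerBr.
have LM z : `|L z| <= (M + 1) * `|z|.
  apply: le_trans (ler_normB _ _) _; rewrite mulrDl mul1r.
  apply: lerD (hprod_norm_snd z); apply: le_trans (AM _) _.
  by rewrite ler_pM2l// hprod_norm_fst.
have ab : u * `|A a - b| <= `|(a, b) : hprod X K|.
  rewrite mulrC -ler_pdivlMr// mulrC.
  by apply: le_trans (opnorm_ge LZ LM (a, b)) _; rewrite ler_wpM2r.
rewrite -(sqnormE (A a - b)) -exprMn.
have -> : hdot a a + hdot b b = `|(a, b) : hprod X K| ^+ 2.
  by rewrite hprod_sqnormE /= !sqnormE.
by rewrite ler_pXn2r ?nnegrE// mulr_ge0// ltW.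
Qed.

(** With [p = (px, py)] and [B = u (A, - I)], the two hypotheses add up to
[<dw - B^* B dw + B^* dnu - p, p> >= 0]; substituting this lower bound of
[<dnu, B p>] leaves
[|p|^2 + |dnu - B p|^2 <= |dw|^2 + |dnu|^2 - |B dw|^2 - (|dw - p|^2 - |B (dw - p)|^2)],
whose last bracket is nonnegative because [B] has norm at most one. *)
Lemma LAL_energy (dx px : X) (dy py dnu : K) :
  (forall a b, u ^+ 2 * hdot (A a - b) (A a - b) <= hdot a a + hdot b b) ->
  0 <= hdot (dx - u ^+ 2 *: (adjoint A (A dx) - adjoint A dy)
             + u *: adjoint A dnu - px) px ->
  0 <= hdot (dy - u ^+ 2 *: (- A dx + dy) - u *: dnu - py) py ->
  hdot px px + (hdot py py +
    hdot (dnu - u *: (A px - py)) (dnu - u *: (A px - py))) <=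
  hdot dx dx + (hdot dy dy + hdot dnu dnu).
Proof.
move=> BP; have := BP (dx - px) (dy - py); rewrite linearB /=.
have := mulr_ge0 (sqr_ge0 u) (hdotxx_ge0 (A dx - dy)).
have adj v : hdot (adjoint A v) px = hdot v (A px).
  by rewrite hdotC -adjointP// hdotC.
rewrite !hdotE !adj.
rewrite ?(hdotC (A px) (A dx)) ?(hdotC dy (A dx)) ?(hdotC dy (A px)).
rewrite ?(hdotC py (A dx)) ?(hdotC py (A px)) ?(hdotC py dy) ?(hdotC px dx).
rewrite ?(hdotC dnu (A px)) ?(hdotC dnu py).
lra.
Qed.

(** The subdifferentials of [f] and [g] are monotone, which supplies the two
hypotheses of [LAL_energy] for the difference of two inputs. *)
Lemma LAL_nonexpansive :
  opnorm (fun z : hprod X K => A z.1 - z.2) <= u^-1 ->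
  forall z w : H, `|T z - T w| <= `|z - w|.
Proof.
move=> opA [x [y nu]] [x' [y' nu']]; apply: sqnorm_le.
rewrite /T /T_LAL !hprod_hdotE /=.
set ax := _ + u *: adjoint A nu; set ax' := _ + u *: adjoint A nu'.
set ay := _ - u *: nu; set ay' := _ - u *: nu'.
set px := prox f ax; set px' := prox f ax'.
set py := prox g ay; set py' := prox g ay'.
have mx := subgradient_monotone fG (prox_subgradient ax fG)
  (prox_subgradient ax' fG).
have my := subgradient_monotone gG (prox_subgradient ay gG)
  (prox_subgradient ay' gG).
have -> : nu - u *: (A px - py) - (nu' - u *: (A px' - py')) =
    nu - nu' - u *: (A (px - px') - (py - py')).
  by apply: hdot_inj => h; rewrite [A (px - px')]linearB !hdotE; ring.
apply: LAL_energy; first exact: coupling_contraction.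
  move: mx; rewrite -/px -/px'; congr (0 <= _).
  have adj v w : hdot (adjoint A v) w = hdot (A w) v.
    by rewrite hdotC -adjointP.
  rewrite /ax /ax' !hdotE !adj [A (x - x')]linearB !hdotE; ring.
move: my; rewrite -/py -/py'; congr (0 <= _).
rewrite /ay /ay' [A (x - x')]linearB !hdotE; ring.
Qed.

(** At a fixed point the dual update forces [y = A x], so that the two proximal
steps become the inclusions [u A^* nu \in df(x)] and [- u nu \in dg(A x)]. *)
Lemma fixed_LAL (x : X) (y nu : K) :
  Fix T (x, (y, nu)) <-> [/\ y = A x, subgradient f x (u *: adjoint A nu) &
    subgradient g y (- (u *: nu))].
Proof.
have ax : A x = y ->
    x - u ^+ 2 *: (adjoint A (A x) - adjoint A y) + u *: adjoint A nu =
    x + u *: adjoint A nu.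
  by move=> ->; rewrite subrr scaler0 subr0.
have ay : A x = y -> y - u ^+ 2 *: (- A x + y) - u *: nu = y - u *: nu.
  by move=> ->; rewrite addNr scaler0 subr0.
split; rewrite /Fix /T /T_LAL /=.
  move=> [ex ey]; rewrite ex ey => enu.
  have Axy : A x = y.
    apply/eqP; rewrite -subr_eq0; apply/eqP.
    move/eqP: enu; rewrite -subr_eq0 addrAC subrr add0r oppr_eq0.
    by rewrite scaler_eq0 gt_eqF//= => /eqP.
  rewrite ax// in ex; rewrite ay// in ey; split=> //.
  - have := prox_subgradient (x + u *: adjoint A nu) fG.
    by rewrite ex addrAC subrr add0r.
  - have := prox_subgradient (y - u *: nu) gG.
    by rewrite ey addrAC subrr add0r.
move=> [yA fx gy]; rewrite ax ?ay//.
have -> : prox f (x + u *: adjoint A nu) = x.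
  by apply: subgradient_prox => //; rewrite addrAC subrr add0r.
have -> : prox g (y - u *: nu) = y.
  by apply: subgradient_prox => //; rewrite addrAC subrr add0r.
by rewrite yA subrr scaler0 subr0.
Qed.

(** Adding the two subgradient inequalities cancels the dual terms. *)
Lemma fixed_LAL_minimizer (z : H) : Fix T z ->
  argmin setT (fun x => f x + g (A x))%E z.1.
Proof.
case: z => x [y nu] /fixed_LAL[-> fx gy]; split=> // x' _ /=.
have := fx x'; have := gy (A x').
have -> : hdot (- (u *: nu)) (A x' - A x) = - hdot (u *: adjoint A nu) (x' - x).
  by rewrite hdotNl !hdotZl -linearB /= hdotC adjointP// hdotC.
have fxE := Gamma0_fin fG (subgradient_dom fG fx).
have gyE := Gamma0_fin gG (subgradient_dom gG gy).
rewrite fxE gyE -!EFinD => le1 le2; apply: le_trans (leeD le2 le1).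
by rewrite -EFinD lee_fin; lra.
Qed.

End LAL.


(** * Lipschitz maps, averaged maps and gradients *)

Section NonexpansiveMaps.
Context {R : realType} {X : hilbertType R}.

Lemma klipschitzP (Y : hilbertType R) (k : R) (h : X -> Y) :
  k.-lipschitz h <-> forall x y, `|h x - h y| <= k * `|x - y|.
Proof.
by split=> [hk x y|hk [x y] _]; [exact: (hk (x, y))|exact: hk].
Qed.

Lemma relaxE alpha (T : X -> X) z :
  relax alpha T z = z - alpha *: (z - T z).
Proof. by rewrite /relax scalerBl scale1r scalerBr opprB addrA addrAC. Qed.

Lemma relax_nonexpansive alpha (T : X -> X) : 0 < alpha < 1 ->
  (forall z w, `|T z - T w| <= `|z - w|) ->
  forall z w, `|relax alpha T z - relax alpha T w| <= `|z - w|.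
Proof.
move=> /andP[a0 a1] TN z w.
have -> : relax alpha T z - relax alpha T w =
    (1 - alpha) *: (z - w) + alpha *: (T z - T w).
  by rewrite /relax !scalerBr opprD addrACA.
apply: le_trans (ler_normD _ _) _; rewrite !normrZ !gtr0_norm ?subr_gt0//.
have := TN z w; rewrite -(ler_pM2l a0); lra.
Qed.

End NonexpansiveMaps.

Section Gradients.
Context {R : realType} {X : hilbertType R}.
Implicit Types (Theta : X -> R) (x y h : X).

Lemma is_gradient_unique Theta x v w :
  is_gradient Theta x v -> is_gradient Theta x w -> v = w.
Proof.
move=> gv gw; apply: hdot_inj => h.
by rewrite -(@derive_val _ _ _ _ _ _ _ (gv h)) -(@derive_val _ _ _ _ _ _ _ (gw h)).
Qed.

Lemma gradientP Theta x : gateaux_differentiable Theta ->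
  is_gradient Theta x (gradient Theta x).
Proof.
move=> dT; rewrite /gradient; case: xgetP => // none.
by have [v /none] := dT x.
Qed.

Lemma gradient_eq Theta x v : is_gradient Theta x v -> gradient Theta x = v.
Proof.
move=> gv; rewrite /gradient; case: xgetP => [w _ gw|/(_ v)//].
exact: is_gradient_unique gw gv.
Qed.

(** The difference quotients of a convex function along [y - x] are bounded by
the secant slope, and their limit is the directional derivative. *)
Lemma gradient_le Theta x y : convex_efun (EFin \o Theta) ->
  gateaux_differentiable Theta ->
  Theta x + hdot (gradient Theta x) (y - x) <= Theta y.
Proof.
move=> cT dT; have gx := gradientP x dT (y - x).
rewrite -lerBrDl hdotC -(@derive_val _ _ _ _ _ _ _ gx) leNgt; apply/negP => lt.
have dc : (fun h : R => h^-1 *: ((Theta \o shift x) (h *: (y - x)) - Theta x))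
  @ 0^' --> 'D_(y - x) Theta x by exact: (@ex_derive _ _ _ _ _ _ _ gx).
have := cvgr_gt _ dc _ lt; rewrite near_withinE => -[e /= e0 eP].
pose t := Num.min (e / 2) 2^-1.
have e2 : 0 < e / 2 by rewrite divr_gt0.
have t0 : 0 < t by rewrite lt_min e2/= invr_gt0.
have t1 : t < 1 by rewrite gt_min; apply/orP; right; lra.
have te : t < e by rewrite gt_min; apply/orP; left; lra.
have := eP t; rewrite /= sub0r normrN gtr0_norm// => /(_ te).
rewrite gt_eqF// => /(_ isT); rewrite ltr_pdivlMl//.
have t01 : 0 < t < 1 by rewrite t0.
have := cT y x t t01; rewrite /= -!EFinM -EFinD lee_fin.
have -> : t *: y + (1 - t) *: x = t *: (y - x) + x.
  by rewrite scalerBl scale1r scalerBr addrA addrAC.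
lra.
Qed.

Lemma gradient_monotone Theta x y : convex_efun (EFin \o Theta) ->
  gateaux_differentiable Theta ->
  0 <= hdot (gradient Theta x - gradient Theta y) (x - y).
Proof.
move=> cT dT; have := gradient_le x y cT dT; have := gradient_le y x cT dT.
rewrite !hdotE; lra.
Qed.

End Gradients.

Lemma is_gradient_fst (R : realType) (X Y : hilbertType R) (Psi : X -> R)
    (z : hprod X Y) (v : X) :
  is_gradient Psi z.1 v ->
  is_gradient (fun w : hprod X Y => Psi w.1) z ((v, 0) : hprod X Y).
Proof.
move=> gv h; have [d1 d2] := gv h.1.
have -> : hdot h ((v, 0) : hprod X Y) = hdot h.1 v.
  by rewrite hprod_hdotE /= hdot0r addr0.
by split.
Qed.

(** * Finite-dimensional Hilbert spaces *)

Section FiniteDimension.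
Context {R : realType} {X : hilbertType R}.

(** An orthonormal basis satisfies this identity, and the identity gives what a
basis is wanted for below: coordinates bounded by the norm, and linear functionals
written as inner products. Unlike orthonormality, it passes to a factor of
a product by projecting the family. *)
Definition parseval_frame (e : seq X) : Prop :=
  forall x, x = \sum_(v <- e) hdot x v *: v.

Lemma hdot_sum_frame (e : seq X) (x w : X) :
  w = \sum_(v <- e) hdot w v *: v ->
  hdot (\sum_(v <- e) hdot x v *: v) w = hdot x w.
Proof.
move=> we; rewrite [in RHS]we.
rewrite (big_morph (fun y => hdot y w) (fun y z => hdotDl y z w) (hdot0l w)).
rewrite (big_morph (hdot x) (hdotDr x) (hdot0r x)).
by apply: eq_bigr => v _; rewrite hdotZl hdotZr mulrC (hdotC v).
Qed.

(** Gram-Schmidt: normalize the component of the new vector orthogonal to the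
family built so far, or drop it when that component vanishes. *)
Lemma frame_of_seq (s : seq X) : exists e : seq X,
  forall x, x \in s \/ x \in e -> x = \sum_(v <- e) hdot x v *: v.
Proof.
elim: s => [|x s [e eP]]; first by exists [::] => x [].
pose r := x - \sum_(v <- e) hdot x v *: v.
have re w : w \in e -> hdot r w = 0.
  move=> we; rewrite /r hdotBl hdot_sum_frame ?subrr//.
  by apply: eP; right.
have rP y : y = \sum_(v <- e) hdot y v *: v -> hdot y r = 0.
  move=> ->.
  rewrite (big_morph (fun y => hdot y r) (fun y z => hdotDl y z r) (hdot0l r)).
  apply: big1_seq => v /andP[_ ve].
  by rewrite hdotZl (hdotC v) re ?mulr0.
have [r0|r0] := eqVneq r 0.
  exists e => y [|ye]; last by apply: eP; right.
  rewrite inE => /predU1P[->|ys]; last by apply: eP; left.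
  by apply/eqP; rewrite -subr_eq0 -/r r0.
have nr0 : `|r| != 0 by rewrite normr_eq0.
pose w := `|r|^-1 *: r.
have ew (y : X) : hdot y r = 0 -> y = \sum_(v <- e) hdot y v *: v ->
    y = \sum_(v <- w :: e) hdot y v *: v.
  by move=> yr ye; rewrite big_cons {1}/w hdotZr yr mulr0 scale0r add0r.
have rr : hdot r r = `|r| ^+ 2 by rewrite sqnormE.
exists (w :: e) => y; rewrite !inE.
move=> [/predU1P[->|ys]|/predU1P[->|ye]].
- have xr : hdot x r = `|r| ^+ 2.
    rewrite -[x](subrK (\sum_(v <- e) hdot x v *: v)) -/r hdotDl rr.
    rewrite [X in _ + X]rP ?addr0//; apply: eq_big_seq => v ve.
    by rewrite hdot_sum_frame//; apply: eP; right.
  rewrite big_cons /w hdotZr xr scalerA.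
  have -> : `|r|^-1 * `|r| ^+ 2 * `|r|^-1 = 1 by field.
  by rewrite scale1r subrK.
- by apply: ew; [apply: rP|]; apply: eP; left.
- rewrite big_cons big1_seq; last first.
    by move=> v /andP[_ ve]; rewrite /w hdotZl re// mulr0 scale0r.
  have -> : hdot w w = 1 by rewrite /w hdotZl hdotZr rr; field.
  by rewrite addr0 scale1r.
- by apply: ew; [apply: rP|]; apply: eP; right.
Qed.

Lemma finite_dim_frame : finite_dim X -> exists e : seq X, parseval_frame e.
Proof.
move=> [s sT]; have [e eP] := frame_of_seq s; exists e => x.
have : Defs.span [set` s] x by rewrite sT.
move=> [n [a [t [ts ->]]]].
under [RHS]eq_bigr => v _.
  rewrite (big_morph (fun y => hdot y v) (fun y z => hdotDl y z v) (hdot0l v)).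
  rewrite scaler_suml.
  over.
rewrite exchange_big /=; apply: eq_bigr => i _.
rewrite {1}(eP (t i)); last by left; apply: ts.
by rewrite scaler_sumr; apply: eq_bigr => v _; rewrite hdotZl scalerA.
Qed.

(** The bounded set lies in the continuous image of a compact box of coordinate
vectors with respect to a frame. *)
Lemma finite_dim_compact (C : set X) (M : R) : finite_dim X -> closed C ->
  (forall x, C x -> `|x| <= M) -> compact C.
Proof.
move=> /finite_dim_frame[e eP] Cc CM.
pose F (v : 'rV[R]_(size e)) : X := \sum_(i < size e) v ord0 i *: e`_i.
pose box := [set v : 'rV[R]_(size e) |
  forall i : 'I_(size e), `[- (M * `|e`_i|), M * `|e`_i|]%classic (v ord0 i)].
have boxc : compact box.
  apply: (@rV_compact _ _
    (fun i : 'I_(size e) => `[- (M * `|e`_i|), M * `|e`_i|]%classic)).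
  by move=> i; exact: segment_compact.
have Fc : continuous F.
  have Fi (i : 'I_(size e)) :
      continuous (fun v : 'rV[R]_(size e) => v ord0 i *: e`_i).
    move=> v.
    have vi := @coord_continuous R 1 (size e) ord0 i v.
    exact: (@cvgZr_tmp _ _ _ (nbhs v) (nbhs_filter v) _ _ _ vi).
  exact: (continuous_big (P := xpredT) (@add_continuous X) (fun i _ => Fi i)).
apply: (subclosed_compact Cc (continuous_compact (continuous_subspaceT Fc) boxc)).
move=> x Cx; exists (\row_i hdot x e`_i).
  move=> i; rewrite /= mxE in_itv /=.
  have xM : `|x| * `|e`_i| <= M * `|e`_i| by rewrite ler_wpM2r// CM.
  by rewrite (le_trans _ (hdot_ge _ _)) ?lerN2// (le_trans (hdot_le _ _)).
rewrite [RHS]eP (big_nth 0) big_mkord; apply: eq_bigr => i _.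
by rewrite mxE.
Qed.

Lemma compact_pos_lower_bound (C : set X) (h : X -> R) : compact C ->
  continuous h -> (forall x, C x -> 0 < h x) ->
  exists2 m, 0 < m & forall x, C x -> m <= h x.
Proof.
move=> Cc hc hpos; have [->|/set0P C0] := eqVneq C set0; first by exists 1.
have [c cC cmin] := compact_EVT_min C0 Cc (continuous_subspaceT hc).
exists (h c) => [|x Cx]; first by apply/hpos/set_mem.
exact/cmin/mem_set.
Qed.

End FiniteDimension.

Lemma parseval_frame_fst (R : realType) (X Y : hilbertType R)
    (e : seq (hprod X Y)) :
  parseval_frame e -> parseval_frame [seq v.1 | v <- e].
Proof.
move=> eP x; have := congr1 fst (eP (x, 0)); rewrite /= => xE.
rewrite {1}xE (big_morph (fun z : hprod X Y => z.1) (op2 := +%R) (id2 := 0)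
  (fun _ _ => erefl) erefl) big_map.
by apply: eq_bigr => v _; rewrite hprod_hdotE /= hdot0l addr0.
Qed.

Lemma parseval_frame_snd (R : realType) (X Y : hilbertType R)
    (e : seq (hprod X Y)) :
  parseval_frame e -> parseval_frame [seq v.2 | v <- e].
Proof.
move=> eP y; have := congr1 snd (eP (0, y)); rewrite /= => yE.
rewrite {1}yE (big_morph (fun z : hprod X Y => z.2) (op2 := +%R) (id2 := 0)
  (fun _ _ => erefl) erefl) big_map.
by apply: eq_bigr => v _; rewrite hprod_hdotE /= hdot0l add0r.
Qed.

(** * Lagrange multipliers under the qualification condition *)

Section Multipliers.
Context {R : realType} {K : hilbertType R}.
Implicit Types (E : K -> R -> Prop) (v w : K) (r s t : R).

(** [E v r] stands for a perturbation [v] achievable at cost [r]. Such an [E] is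
a convex cone lying over a linear subspace; it plays the part of the epigraph of
a sublinear function on that subspace. *)
Definition cost_cone E : Prop :=
  [/\ E 0 0, forall v w r s, E v r -> E w s -> E (v + w) (r + s),
      forall t v r, 0 < t -> E v r -> E (t *: v) (t * r),
      forall v r, E v r -> exists s, E (- v) s & forall r, E 0 r -> 0 <= r].

(** The one-dimensional step of the Hahn-Banach argument: the slope [c] along
[v] has to lie between the costs [- r] of [- v] and the costs [r] of [v], and
the supremum of the former does; when [v] is outside the domain any slope is
suitable. *)
Lemma cost_cone_extend E v : cost_cone E -> exists E' c, [/\ cost_cone E',
  forall w r, E w r -> E' w r, E' v c & E' (- v) (- c)].
Proof.
move=> [E0 ED EZ EN Epos].
suff [c cP] : exists c, forall t s, E (t *: v) s -> t * c <= s.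
  exists (fun w r => exists t w' s,
    [/\ E w' s, w = w' + t *: v & r = s + t * c]), c; split.
  - split.
    + by exists 0, 0, 0; rewrite scale0r mul0r !addr0.
    + move=> _ _ _ _ [t [w [s [ws -> ->]]]] [t' [w' [s' [ws' -> ->]]]].
      exists (t + t'), (w + w'), (s + s'); split; first exact: ED.
        by rewrite scalerDl addrACA.
      by rewrite mulrDl addrACA.
    + move=> a _ _ a0 [t [w [s [ws -> ->]]]].
      exists (a * t), (a *: w), (a * s); split; first exact: EZ.
        by rewrite scalerDr scalerA.
      by rewrite mulrDr mulrA.
    + move=> _ _ [t [w [s [ws -> _]]]]; have [s' ws'] := EN _ _ ws.
      exists (s' + - t * c), (- t), (- w), s'; split=> //.
      by rewrite opprD scaleNr.
    + move=> _ [t [w [s [ws w0 ->]]]].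
      have wE : w = (- t) *: v by apply/eqP; rewrite scaleNr -addr_eq0 -w0.
      rewrite wE in ws; have := cP _ _ ws; lra.
  - by move=> w r wr; exists 0, w, r; rewrite scale0r mul0r !addr0.
  - by exists 1, 0, 0; rewrite scale1r mul1r !add0r.
  - by exists (-1), 0, 0; rewrite scaleN1r mulN1r !add0r.
have [[r1 vr1]|none] := pselect (exists r, E v r); last first.
  exists 0 => t s ts; rewrite mulr0.
  have [t0|t0|t0] := ltgtP t 0; last by apply: Epos; rewrite t0 scale0r in ts.
  - have [s' ts'] := EN _ _ ts; case: none; exists (- t^-1 * s').
    have := EZ (- t^-1) _ _ _ ts'; rewrite oppr_gt0 invr_lt0 => /(_ t0).
    by rewrite scalerN scaleNr opprK scalerA mulVf ?scale1r// lt_eqF.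
  - case: none; exists (t^-1 * s).
    have := EZ t^-1 _ _ _ ts; rewrite invr_gt0 => /(_ t0).
    by rewrite scalerA mulVf ?scale1r// gt_eqF.
have [r2 vr2] := EN _ _ vr1.
pose S := [set - r | r in [set r | E (- v) r]].
have Sub r : E v r -> ubound S r.
  move=> vr _ [s /= vs <-]; have := ED _ _ _ _ vr vs.
  by rewrite subrr => /Epos; lra.
exists (sup S) => t s ts.
have [t0|t0|t0] := ltgtP t 0; last first.
- by rewrite t0 mul0r; apply: Epos; rewrite t0 scale0r in ts.
- have /Sub/ge_sup supS : E v (t^-1 * s).
    have := EZ t^-1 _ _ _ ts; rewrite invr_gt0 => /(_ t0).
    by rewrite scalerA mulVf ?scale1r// gt_eqF.
  by rewrite -ler_pdivlMl//; apply: supS; exists (- r2), r2.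
- have vs : E (- v) (- t^-1 * s).
    have := EZ (- t^-1) _ _ _ ts; rewrite oppr_gt0 invr_lt0 => /(_ t0).
    by rewrite scalerA mulNr mulVf ?scaleN1r// lt_eqF.
  have : - (- t^-1 * s) <= sup S.
    by apply: ub_le_sup; [exists r1; exact: Sub|exists (- t^-1 * s)].
  have {2}-> : s = t * (t^-1 * s) by rewrite mulrA divff ?mul1r// lt_eqF.
  by rewrite mulNr opprK ler_nM2l.
Qed.

Lemma cost_cone_extend_seq (e : seq K) E : cost_cone E ->
  exists E' (c : K -> R), [/\ cost_cone E', forall w r, E w r -> E' w r &
    forall v, v \in e -> E' v (c v) /\ E' (- v) (- c v)].
Proof.
elim: e E => [|v e IH] E EC; first by exists E, (fun=> 0).
have [E1 [a [E1C E1E va va']]] := cost_cone_extend v EC.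
have [E2 [c [E2C E2E cP]]] := IH _ E1C.
exists E2, (fun w => if w == v then a else c w); split=> //.
  by move=> w r /E1E/E2E.
move=> w; rewrite inE; have [->|_ /=] := eqVneq w v; last exact: cP.
by split; exact: E2E.
Qed.

(** Extending along every vector of a frame makes the cost linear, hence given
by an inner product. *)
Lemma cost_cone_multiplier (e : seq K) E : parseval_frame e -> cost_cone E ->
  exists eta, forall v r, E v r -> hdot v eta <= r.
Proof.
move=> eP EC; have [E' [c [[E0 ED EZ EN Epos] EE' cP]]] := cost_cone_extend_seq e EC.
have line a v : v \in e -> E' (a *: v) (a * c v).
  move=> ve; have [v1 v2] := cP v ve.
  have [a0|a0|->] := ltgtP a 0; last by rewrite scale0r mul0r.
  - have := EZ (- a) _ _ _ v2; rewrite oppr_gt0 => /(_ a0).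
    by rewrite scalerN scaleNr opprK mulrNN.
  - exact: EZ.
exists (\sum_(v <- e) c v *: v) => v r /EE' vr.
have : E' (- v) (- hdot v (\sum_(w <- e) c w *: w)).
  rewrite [- v]eP (big_morph (hdot v) (hdotDr v) (hdot0r v)) -sumrN.
  have : {subset e <= e} by [].
  elim: {1 3 4}e => [|w s IH] se; first by rewrite !big_nil.
  rewrite !big_cons; apply: ED.
    have -> : - hdot v (c w *: w) = hdot (- v) w * c w.
      by rewrite hdotZr hdotNl; ring.
    by apply: line; apply: se; rewrite mem_head.
  by apply: IH => x xs; apply: se; rewrite inE xs orbT.
by move/(ED _ _ _ _ vr); rewrite subrr => /Epos; lra.
Qed.

End Multipliers.

Section Duality.
Context {R : realType} {X K : hilbertType R}.
Variables (f : X -> \bar R) (g : K -> \bar R) (A : {linear X -> K}).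
Hypotheses (fG : Gamma0 f) (gG : Gamma0 g) (Ac : continuous A).

(** The cost of a perturbation [t (y - A x)] is [t] times the excess of
[f x + g y] over the optimal value. Its domain is the cone generated by
[dom g - A (dom f)], which the qualification condition makes a subspace. *)
Lemma multiplier_exists (e : seq K) (x : X) : parseval_frame e ->
  sri [set y - w | y in dom g & w in [set A x | x in dom f]] 0 ->
  argmin setT (fun x => f x + g (A x))%E x ->
  exists eta, subgradient f x (- adjoint A eta) /\ subgradient g (A x) eta.
Proof.
move=> eP [[y0 gy0 [_ [x0 fx0 <-] yx0]] coneD] [_ xmin].
have y0E : y0 = A x0 by apply/eqP; rewrite -subr_eq0 yx0.
have := xmin x0 I; rewrite -y0E (Gamma0_fin fG fx0) (Gamma0_fin gG gy0).
have [fNy _ _ _] := fG; have [gNy _ _ _] := gG.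
move=> lefin.
have [fx gx] : dom f x /\ dom g (A x).
  move: lefin; rewrite /dom /=; have := fNy x; have := gNy (A x).
  by case: (f x) => [a| |]; case: (g (A x)) => [b| |] // _ _ _; rewrite !ltry.
have fE := Gamma0_fin fG fx; have gE := Gamma0_fin gG gx.
pose m := fine (f x) + fine (g (A x)).
have mle x' : dom f x' -> dom g (A x') -> m <= fine (f x') + fine (g (A x')).
  move=> fx' gx'; have := xmin x' I.
  by rewrite fE gE (Gamma0_fin fG fx') (Gamma0_fin gG gx') -!EFinD lee_fin.
pose E (v : K) (r : R) := exists t x' y', [/\ 0 < t, dom f x', dom g y',
  v = t *: (y' - A x') & t * (fine (f x') + fine (g y') - m) <= r].
have EC : cost_cone E.
  split.
  - exists 1, x, (A x); split=> //; first by rewrite subrr scaler0.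
    by rewrite /m subrr mulr0.
  - move=> v v' r r' [t [a [b [t0 fa gb -> le]]]] [t' [a' [b' [t'0 fa' gb' -> le']]]].
    have tt0 : 0 < t + t' by rewrite addr_gt0.
    pose l := t / (t + t').
    have l01 : 0 < l < 1.
      by rewrite divr_gt0//= ltr_pdivrMr// mul1r ltrDl.
    have tl : (t + t') * l = t by rewrite mulrC divfK// gt_eqF.
    have tl' : (t + t') * (1 - l) = t' by rewrite mulrBr tl mulr1 addrC addKr.
    have [fc fle] := Gamma0_convex fG fa fa' l01.
    have [gc gle] := Gamma0_convex gG gb gb' l01.
    exists (t + t'), (l *: a + (1 - l) *: a'), (l *: b + (1 - l) *: b').
    split=> //.
      rewrite [A (_ + _)]linearD [A (l *: a)]linearZ [A (_ *: a')]linearZ /=.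
      by rewrite opprD addrACA -!scalerBr [RHS]scalerDr !scalerA tl tl'.
    move: (lerD fle gle) => h; rewrite -(ler_pM2l tt0) in h; move: h.
    have -> p p' q q' : (t + t') * (l * p + (1 - l) * p' + (l * q + (1 - l) * q'))
        = (t + t') * l * (p + q) + (t + t') * (1 - l) * (p' + q') by ring.
    by rewrite tl tl'; lra.
  - move=> s v r s0 [t [a [b [t0 fa gb -> le]]]].
    exists (s * t), a, b; split=> //; first by rewrite mulr_gt0.
      by rewrite scalerA.
    by rewrite -mulrA ler_pM2l.
  - move=> v r [t [a [b [t0 fa gb -> _]]]].
    have : cone [set c - 0 | c in
        [set y - w | y in dom g & w in [set A x | x in dom f]]]
        (- (t *: (b - A a))).
      rewrite coneD; apply: subset_closure.
      exists 1%N, (fun=> - t), (fun=> b - A a); split.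
        move=> _; exists (b - A a); last by rewrite subr0.
        by exists b => //; exists (A a) => //; exists a.
      by rewrite big_ord1 scaleNr.
    move=> [l [_ [l0 [_ [b' gb' [_ [a' fa' <-] <-]] <-]] ->]]; rewrite subr0.
    by exists (l * (fine (f a') + fine (g b') - m)), l, a', b'.
  - move=> r [t [a [b [t0 fa gb /esym/eqP]]]].
    rewrite scaler_eq0 gt_eqF//= subr_eq0 => /eqP bE; subst b.
    by apply: le_trans; rewrite mulr_ge0 ?(ltW t0)// subr_ge0 mle.
have [eta etaP] := cost_cone_multiplier eP EC.
have {}etaP a b : dom f a -> dom g b ->
    hdot (b - A a) eta <= fine (f a) + fine (g b) - m.
  move=> fa gb; apply: etaP; exists 1, a, b.
  by rewrite scale1r mul1r.
exists eta; split=> [x'|y'].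
- have [fx'|] := boolP (f x' < +oo)%E; last first.
    by rewrite ltey negbK => /eqP ->; rewrite leey.
  rewrite fE (Gamma0_fin fG fx') lee_fin; have := etaP x' (A x) fx' gx.
  have -> : hdot (A x - A x') eta = hdot (- adjoint A eta) (x' - x).
    by rewrite -linearB adjointP// hdotC hdotNl -hdotNr opprB.
  rewrite /m; lra.
- have [gy'|] := boolP (g y' < +oo)%E; last first.
    by rewrite ltey negbK => /eqP ->; rewrite leey.
  rewrite gE (Gamma0_fin gG gy') lee_fin; have := etaP x y' fx gy'.
  by rewrite hdotC /m; lra.
Qed.

End Duality.

(** * Real sequences *)

Section RealSequences.
Context {R : realType}.
Implicit Types (a b d l eps : nat -> R).

Lemma series_nonneg_nondecreasing l : (forall n, 0 <= l n) ->
  {homo series l : m n / (m <= n)%N >-> m <= n}.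
Proof. by move=> l0; apply/nondecreasing_seqP => n; rewrite seriesSr lerDl. Qed.

(** The factors multiply up to at most [expR] of the sum of [eps]. *)
Lemma almost_nonincreasing_bounded b eps B : 0 <= B ->
  (forall n, 0 <= eps n) -> cvgn (series eps) ->
  (\forall n \near \oo, b n.+1 <= (1 + eps n) * Num.max (b n) B) ->
  exists C, \forall n \near \oo, b n <= C.
Proof.
move=> B0 e0 ce [N _ NP].
have snd := series_nonneg_nondecreasing e0.
set B1 := Num.max (b N) B.
have B10 : 0 <= B1 by rewrite le_max B0 orbT.
have H k : b (N + k)%N <= B1 * expR (series eps (N + k)%N - series eps N).
  elim: k => [|k IH].
    by rewrite addn0 subrr expR0 mulr1 le_max lexx.
  rewrite addnS; apply: le_trans (NP _ (leq_addr _ _)) _.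
  rewrite seriesSr addrAC expRD mulrA [leRHS]mulrC.
  have E1 : 1 <= expR (series eps (N + k)%N - series eps N).
    by rewrite -expR0 ler_expR subr_ge0 snd// leq_addr.
  apply: ler_pM; rewrite ?addr_ge0//.
  - by rewrite le_max B0 orbT.
  - exact: expR_ge1Dx.
  - rewrite ge_max IH (@le_trans _ _ B1)//; first by rewrite le_max lexx orbT.
    by rewrite ler_peMr.
exists (B1 * expR (limn (series eps) - series eps N)); exists N => // n /= Nn.
rewrite -(subnKC Nn); apply: le_trans (H _) _.
rewrite ler_wpM2l// ler_expR lerD2r.
exact: nondecreasing_cvgn_le.
Qed.

(** While [d] exceeds [delta] its square decreases by a divergent series, so
[d] must fall below [delta]; later it can only jump back to [2 * delta]. *)
Lemma divergent_descent_cvg0 d l : (forall n, 0 <= d n) ->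
  (forall n, 0 <= l n) -> ~ cvgn (series l) ->
  (forall delta, 0 < delta -> exists2 eta, 0 < eta & \forall n \near \oo,
    (delta <= d n -> d n.+1 ^+ 2 <= d n ^+ 2 - eta * l n) /\
    d n.+1 <= d n + delta) ->
  d @ \oo --> 0.
Proof.
move=> d0 l0 ldiv step; apply/cvgrPdist_le => e e0.
have e2 : 0 < e / 2 by rewrite divr_gt0.
have [eta eta0 [N _ NP]] := step _ e2.
have [m Nm dm] : exists2 m, (N <= m)%N & d m < e / 2.
  apply: contrapT => none; apply: ldiv.
  have large n : (N <= n)%N -> e / 2 <= d n.
    by move=> Nn; rewrite leNgt; apply/negP => dn; apply: none; exists n.
  have H k : eta * series l (N + k)%N + d (N + k)%N ^+ 2 <=
      eta * series l N + d N ^+ 2.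
    elim: k => [|k IH]; first by rewrite addn0.
    rewrite addnS seriesSr; have Nk := leq_addr k N.
    have [/(_ (large _ Nk)) + _] := NP _ Nk.
    by rewrite mulrDr; move: IH; lra.
  apply: (@nondecreasing_is_cvgn _ (series l)).
    exact: series_nonneg_nondecreasing.
  exists (series l N + d N ^+ 2 / eta) => _ [n _ <-].
  apply: (@le_trans _ _ (series l (N + n)%N)).
    by apply: series_nonneg_nondecreasing => //; exact: leq_addl.
  rewrite -(ler_pM2l eta0) mulrDr [eta * (_ / _)]mulrC divfK ?gt_eqF//.
  by apply: le_trans (H n); rewrite lerDl sqr_ge0.
exists m => // n /= mn; rewrite sub0r normrN ger0_norm//.
rewrite -(subnKC mn); elim: (n - m)%N => [|k IH].
  by rewrite addn0; lra.
rewrite addnS; have [dec jump] := NP (m + k)%N (leq_trans Nm (leq_addr _ _)).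
have [small|/ltW large] := leP (d (m + k)%N) (e / 2); first by lra.
apply: le_trans IH; rewrite -(@ler_pXn2r _ 2)// ?nnegrE//.
by apply: le_trans (dec large) _; rewrite gerBl mulr_ge0// ltW.
Qed.

End RealSequences.

(** * Distance to a set *)

Section Distance.
Context {R : realType} {X : hilbertType R}.
Implicit Types (C : set X) (x y p : X).

Lemma dist_le C x p : C p -> dist C x <= `|x - p|.
Proof.
move=> Cp; apply: ge_inf; last by exists p.
by exists 0 => _ [y _ <-].
Qed.

Lemma dist_ge0 C x : 0 <= dist C x.
Proof.
have [->|/set0P [p Cp]] := eqVneq C set0; first by rewrite /dist image_set0 inf0.
by apply: lb_le_inf; [exists `|x - p|, p|move=> _ [y _ <-]].
Qed.

Lemma dist_lt_ex C x r : C !=set0 -> dist C x < r ->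
  exists2 p, C p & `|x - p| < r.
Proof.
move=> [p Cp] xr.
have C0 : [set `|x - y| | y in C] !=set0 by exists `|x - p|, p.
have [r' Cr' r'r] := inf_lt C0 xr; case: Cr' => y Cy yr'.
by exists y; rewrite ?yr'.
Qed.

Lemma le_dist C x r : C !=set0 -> (forall p, C p -> r <= `|x - p|) ->
  r <= dist C x.
Proof.
move=> [p Cp] rC; apply: lb_le_inf; first by exists `|x - p|, p.
by move=> _ [y Cy <-]; exact: rC.
Qed.

Lemma dist_le_dist C x y : C !=set0 -> dist C x <= dist C y + `|x - y|.
Proof.
move=> C0; rewrite -lerBlDr; apply: le_dist => // p Cp.
rewrite lerBlDr addrC; apply: le_trans (dist_le x Cp) _.
by rewrite -{1}(subrK y x) -addrA ler_normD.
Qed.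

Lemma dist_continuous C : C !=set0 -> continuous (dist C).
Proof.
move=> C0; apply: (@lipschitz_le_continuous _ _ _ _ 1) => x y.
have := dist_le_dist x y C0; have := dist_le_dist y x C0.
by rewrite mul1r ler_norml (distrC y x) => h1 h2; apply/andP; split; lra.
Qed.

(** A Fejer-type inequality holding for each point of the set passes to the
distance to the set; the infimum defining [dist] may not be attained. *)
Lemma sqr_dist_le C x y q : C !=set0 ->
  (forall p, C p -> `|y - p| ^+ 2 <= `|x - p| ^+ 2 + q) ->
  dist C y ^+ 2 <= dist C x ^+ 2 + q.
Proof.
move=> C0 yx; rewrite leNgt; apply/negP; rewrite -ltrBrDr => lt.
have pos : 0 <= dist C y ^+ 2 - q by rewrite (le_trans _ (ltW lt))// sqr_ge0.
have : dist C x < Num.sqrt (dist C y ^+ 2 - q).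
  by rewrite -(@ltr_pXn2r _ 2)// ?nnegrE ?sqrtr_ge0 ?dist_ge0// sqr_sqrtr.
move=> /(dist_lt_ex C0)[p Cp].
rewrite -(@ltr_pXn2r _ 2)// ?nnegrE ?sqrtr_ge0// sqr_sqrtr//.
have := yx p Cp; have : dist C y ^+ 2 <= `|y - p| ^+ 2.
  by rewrite ler_pXn2r ?nnegrE ?dist_ge0// dist_le.
lra.
Qed.

End Distance.

(** * The hybrid steepest descent method in finite dimension *)

Section HybridSteepestDescent.
Context {R : realType} {H : hilbertType R}.
Variables (T : H -> H) (Theta : H -> R) (alpha k : R) (lambda : nat -> R).
Hypotheses (fdH : finite_dim H) (TN : forall z w, `|T z - T w| <= `|z - w|)
  (Fbd : bounded_set (Fix T)) (a01 : 0 < alpha < 1)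
  (Tcvx : convex_efun (EFin \o Theta)) (Tdiff : gateaux_differentiable Theta)
  (k0 : 0 <= k)
  (Tlip : forall x y, `|gradient Theta x - gradient Theta y| <= k * `|x - y|).
Hypotheses (l0 : forall n, 0 <= lambda n.+1)
  (l2 : cvgn (series (fun n => lambda n.+1 ^+ 2)))
  (l1 : ~ cvgn (series (fun n => lambda n.+1))).
Let W := argmin (Fix T) (EFin \o Theta).
Hypothesis W0 : W !=set0.
Let N := relax alpha T.
Let G z := z - T z.
Implicit Types (z w p : H).

(** Nonexpansiveness of [T], expanded as [|d - D|^2 <= |d|^2] with [d = z - w]
and [D] the difference of the residuals. *)
Lemma residual_monotone z w :
  2^-1 * `|G z - G w| ^+ 2 <= hdot (G z - G w) (z - w).
Proof.
have : `|T z - T w| ^+ 2 <= `|z - w| ^+ 2 by rewrite ler_pXn2r ?nnegrE.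
have -> : T z - T w = (z - w) - (G z - G w).
  by apply: hdot_inj => h; rewrite /G !hdotE; ring.
move: (G z - G w) (z - w) => D d; rewrite !sqnormE !hdotE (hdotC d D); lra.
Qed.

(** A relaxation step towards [T z] approaches each fixed point by an amount
controlled by the residual. *)
Lemma relax_fejer z p : Fix T p ->
  `|N z - p| ^+ 2 <= `|z - p| ^+ 2 - 2 * alpha * (1 - alpha) * hdot (G z) (z - p).
Proof.
move=> Tp; have := residual_monotone z p.
have -> : G p = 0 by rewrite /G Tp subrr.
rewrite subr0 => h; rewrite {1}/N relaxE -/(G z).
have -> : `|z - alpha *: G z - p| ^+ 2 = `|z - p| ^+ 2
    - 2 * alpha * hdot (G z) (z - p) + alpha ^+ 2 * `|G z| ^+ 2.
  move: (G z) => D.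
  rewrite !sqnormE !hdotE (hdotC z D) (hdotC p D) (hdotC p z); ring.
have := ler_wpM2l (sqr_ge0 alpha) h; lra.
Qed.

Lemma residual_continuous : continuous G.
Proof.
apply: (@lipschitz_le_continuous _ _ _ _ 2) => z w.
have -> : G z - G w = (z - w) - (T z - T w).
  by apply: hdot_inj => h; rewrite /G !hdotE; ring.
apply: le_trans (ler_normB _ _) _; have := TN z w; lra.
Qed.

Lemma norm_sub_continuous p : continuous (fun z => `|z - p|).
Proof.
apply: (@lipschitz_le_continuous _ _ _ _ 1) => x y; rewrite mul1r.
by apply: le_trans (ler_dist_dist _ _) _; rewrite opprB addrA subrK.
Qed.

(** On a sphere enclosing the bounded fixed-point set the residual is bounded
below by compactness; monotonicity of [I - T] along rays from [p] carries this
bound outwards, where it grows linearly. *)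
Lemma residual_growth p : Fix T p -> exists r kappa, [/\ 0 < r, 0 < kappa &
  forall z, r <= `|z - p| -> kappa * `|z - p| <= hdot (G z) (z - p)].
Proof.
move=> Tp; have [M [_ /(_ (`|M| + 1))MP]] := Fbd.
have {}MP z : Fix T z -> `|z| <= `|M| + 1.
  by apply: MP; rewrite ltr_pwDr// ler_norm.
pose r := `|M| + 1 + `|p| + 1.
have r0 : 0 < r by rewrite ltr_wpDl// !addr_ge0.
pose S := [set z | `|z - p| = r].
have Sc : compact S.
  apply: (@finite_dim_compact _ _ _ (r + `|p|)) => //.
    apply: (closed_comp (f := fun z => `|z - p|) (D := [set r])).
      by move=> z _; exact: norm_sub_continuous.
    exact: closed_eq.
  by move=> z /= <-; rewrite -{1}(subrK p z) ler_normD.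
have [||m m0 mP] := compact_pos_lower_bound (h := fun z => `|G z|) Sc.
- by move=> z; apply: cvg_norm; exact: residual_continuous.
- move=> z Sz; rewrite normr_gt0 subr_eq0; apply/eqP => zT.
  have := MP z (esym zT); have := ler_normB z p; rewrite Sz /r; lra.
exists r, (m ^+ 2 / (2 * r)); split=> //.
  by rewrite divr_gt0 ?exprn_gt0 ?mulr_gt0.
move=> z rz; have zp0 : 0 < `|z - p| by apply: lt_le_trans rz.
pose t := r / `|z - p|; pose s := p + t *: (z - p).
have t0 : 0 < t by rewrite divr_gt0.
have t1 : t <= 1 by rewrite ler_pdivrMr// mul1r.
have sp : s - p = t *: (z - p) by rewrite /s addrAC subrr add0r.
have Ss : S s by rewrite /S /= sp normrZ gtr0_norm// divfK// gt_eqF.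
have h1 : 2^-1 * m ^+ 2 <= t * hdot (G s) (z - p).
  rewrite -hdotZr -sp.
  have := residual_monotone s p; have -> : G p = 0 by rewrite /G Tp subrr.
  rewrite subr0; apply: le_trans.
  by rewrite ler_pM2l// ler_pXn2r ?nnegrE ?(ltW m0)// mP.
have h2 : hdot (G s) (z - p) <= hdot (G z) (z - p).
  have := t1; rewrite le_eqVlt => /predU1P[tE|tlt].
    by have -> : s = z by rewrite /s tE scale1r addrC subrK.
  have := residual_monotone z s.
  have -> : z - s = (1 - t) *: (z - p).
    by apply: hdot_inj => h; rewrite /s !hdotE; ring.
  have := sqr_ge0 `|G z - G s|; rewrite hdotZr => q0 q1.
  have : 0 <= (1 - t) * hdot (G z - G s) (z - p) by lra.
  by rewrite pmulr_rge0 ?subr_gt0// hdotBl subr_ge0.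
apply: le_trans h2; rewrite -(ler_pM2l t0); apply: le_trans h1.
rewrite le_eqVlt; apply/orP; left; apply/eqP.
by rewrite /t; field; rewrite !gt_eqF.
Qed.

Variable z_ : nat -> H.
Hypothesis zS : hsdm_iteration N Theta lambda z_.

Lemma lambda_cvg0 : (fun n => lambda n.+1) @ \oo --> 0.
Proof.
have l20 := cvg_series_cvg_0 l2; apply/cvgrPdist_lt => e e0.
have e2 : 0 < e ^+ 2 by rewrite exprn_gt0.
move/cvgrPdist_lt/(_ _ e2): l20; apply: filterS => n.
rewrite !sub0r !normrN normrX ltr_pXn2r// nnegrE ltW//.
Qed.

Lemma lambda_small a b : 0 <= a -> 0 < b ->
  \forall n \near \oo, lambda n.+1 * a <= b.
Proof.
move=> a_ge0 b0; have ba0 : 0 < b / (a + 1) by rewrite divr_gt0// ltr_wpDl.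
move/cvgrPdist_lt/(_ _ ba0): lambda_cvg0; apply: filterS => n.
rewrite sub0r normrN ger0_norm ?l0// ltr_pdivlMr ?ltr_wpDl// => lt.
by apply: le_trans (ltW lt); rewrite ler_wpM2l ?l0// lerDl.
Qed.

Lemma relax_le z p : Fix T p -> `|N z - p| <= `|z - p|.
Proof.
move=> Tp; have := relax_nonexpansive a01 TN z p.
by rewrite [X in _ - X]relaxE Tp subrr scaler0 subr0.
Qed.

Lemma gradient_norm_le z p :
  `|gradient Theta z| <= `|gradient Theta p| + k * `|z - p|.
Proof.
rewrite -{1}(subrK (gradient Theta p) (gradient Theta z)) addrC.
by apply: le_trans (ler_normD _ _) _; rewrite lerD2l.
Qed.

Lemma step_sqnorm n p : `|z_ n.+1 - p| ^+ 2 = `|N (z_ n) - p| ^+ 2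
  - 2 * lambda n.+1 * hdot (gradient Theta (N (z_ n))) (N (z_ n) - p)
  + lambda n.+1 ^+ 2 * `|gradient Theta (N (z_ n))| ^+ 2.
Proof.
rewrite zS; move: (N (z_ n)) => w; move: (gradient Theta w) => v.
rewrite !sqnormE !hdotE (hdotC w v) (hdotC p v) (hdotC p w); ring.
Qed.

(** Far from [p] the decrease of the relaxation step, linear in the distance,
absorbs the first-order error of the gradient step; only the second-order error
remains, and it is summable. *)
Lemma iterates_bounded p : Fix T p ->
  exists2 rad, 0 <= rad & \forall n \near \oo, `|z_ n - p| <= rad.
Proof.
move=> Tp; have [r [kappa [r0 kappa0 growth]]] := residual_growth Tp.
have [a0 a1] := andP a01.
pose c := 2 * alpha * (1 - alpha) * kappa.
have c0 : 0 < c by rewrite !mulr_gt0// subr_gt0.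
pose M := `|gradient Theta p|; have M0 : 0 <= M by rewrite /M.
pose eps n := 2 * k ^+ 2 * lambda n.+1 ^+ 2.
have eps0 n : 0 <= eps n by rewrite !mulr_ge0// sqr_ge0.
have [C CP] : exists C, \forall n \near \oo, `|z_ n - p| ^+ 2 <= C.
  (* The constant c * r leaves room for the first-order error of a step that
     starts inside the ball of radius r. *)
  apply: (@almost_nonincreasing_bounded _ _ eps (r ^+ 2 + c * r)) => //.
  - by rewrite addr_ge0 ?sqr_ge0// mulr_ge0// ltW.
  - rewrite (_ : eps = (2 * k ^+ 2) *: (fun n => lambda n.+1 ^+ 2)) //.
    exact: is_cvg_seriesZ.
  have c2 : 0 < c / 4 by rewrite divr_gt0.
  have near1 := lambda_small M0 c2.
  have cr0 : 0 < c * r / 4 by rewrite divr_gt0// mulr_gt0.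
  have near2 := lambda_small (sqr_ge0 M) cr0.
  have near3 := lambda_small ler01 ltr01.
  near=> n.
  have s1 : lambda n.+1 * M <= c / 4 by near: n.
  have s2 : lambda n.+1 * M ^+ 2 <= c * r / 4 by near: n.
  have s3 : lambda n.+1 * 1 <= 1 by near: n.
  have ln := l0 n; rewrite step_sqnorm.
  set a := `|z_ n - p|; set w := N (z_ n); set v := gradient Theta w.
  have wa : `|w - p| <= a by exact: relax_le.
  have w0 : 0 <= `|w - p| by [].
  have hv : - (M * `|w - p|) <= hdot v (w - p).
    have := gradient_monotone w p Tcvx Tdiff; rewrite hdotBl -/v.
    have := hdot_ge (gradient Theta p) (w - p); rewrite -/M; lra.
  have vv : `|v| ^+ 2 <= 2 * M ^+ 2 + 2 * k ^+ 2 * `|w - p| ^+ 2.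
    have := gradient_norm_le w p; rewrite -/v -/M => vle.
    have : `|v| ^+ 2 <= (M + k * `|w - p|) ^+ 2.
      by rewrite ler_pXn2r// nnegrE// addr_ge0// mulr_ge0.
    have := sqr_ge0 (M - k * `|w - p|); nra.
  have t1 : lambda n.+1 * - (M * a) <= lambda n.+1 * hdot v (w - p).
    by rewrite ler_wpM2l// (le_trans _ hv)// lerN2 ler_wpM2l.
  have t2 := ler_wpM2l (sqr_ge0 (lambda n.+1)) vv.
  have t3 : lambda n.+1 ^+ 2 * M ^+ 2 <= c * r / 4.
    apply: le_trans s2; rewrite expr2 -mulrA ler_piMl ?mulr_ge0 ?sqr_ge0//.
    by rewrite -[leLHS]mulr1.
  have aa0 : 0 <= a by rewrite /a.
  have t4 : lambda n.+1 * M * a <= c / 4 * a by rewrite ler_wpM2r.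
  have [ra|/ltW ar] := leP r a.
    have wsq : `|w - p| ^+ 2 <= a ^+ 2 - c * a.
      apply: le_trans (relax_fejer _ Tp) _; rewrite -/a lerD2l lerN2.
      have := growth _ ra; rewrite -/a -(@ler_pM2l _ (2 * alpha * (1 - alpha))).
        by rewrite mulrA.
      by rewrite !mulr_gt0// subr_gt0.
    have t5 : eps n * `|w - p| ^+ 2 <= eps n * a ^+ 2.
      by rewrite ler_wpM2l// ler_pXn2r ?nnegrE.
    have t6 : c * r <= c * a by rewrite ler_pM2l.
    apply: (@le_trans _ _ ((1 + eps n) * a ^+ 2)); last first.
      by rewrite ler_wpM2l ?addr_ge0// le_max lexx.
    move: t1 t2 t3 t4 t5 t6 wsq; rewrite /eps; lra.
  apply: (@le_trans _ _ ((1 + eps n) * (r ^+ 2 + c * r))); last first.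
    by rewrite ler_wpM2l ?addr_ge0// le_max lexx orbT.
  have wr : `|w - p| ^+ 2 <= r ^+ 2.
    by rewrite ler_pXn2r ?nnegrE ?(ltW r0)// (le_trans wa).
  have t5 : eps n * `|w - p| ^+ 2 <= eps n * r ^+ 2 by rewrite ler_wpM2l.
  have t6 : c * a <= c * r by rewrite ler_pM2l.
  have t7 : 0 <= eps n * (c * r) by rewrite mulr_ge0// ltW// mulr_gt0.
  move: t1 t2 t3 t4 t5 t6 t7 wr; rewrite /eps; lra.
exists (Num.sqrt `|C|); first exact: sqrtr_ge0.
move: CP; apply: filterS => n nC.
rewrite -(@ler_pXn2r _ 2)// ?nnegrE ?sqrtr_ge0// sqr_sqrtr//.
by apply: le_trans nC _; exact: ler_norm.
Unshelve. all: by end_near. Qed.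

Lemma objective_continuous : continuous Theta.
Proof.
move=> x; apply/cvgrPdist_lt => e e0.
pose B := `|gradient Theta x| + k + 1.
have B0 : 0 < B by rewrite ltr_wpDl// addr_ge0.
near=> y.
have xy1 : `|x - y| < 1.
  by near: y; apply: (@cvgr_dist_lt _ _ _ (nbhs x)); [exact: cvg_id|exact: ltr01].
have xye : `|x - y| < e / B.
  by near: y; apply: (@cvgr_dist_lt _ _ _ (nbhs x)); [exact: cvg_id|rewrite divr_gt0].
have gxB : `|gradient Theta x| <= B by rewrite /B -addrA lerDl addr_ge0.
have gyB : `|gradient Theta y| <= B.
  apply: le_trans (gradient_norm_le y x) _; rewrite /B -addrA lerD2l distrC.
  have : k * `|x - y| <= k * 1 by rewrite ler_wpM2l// ltW.
  lra.
have bound z h : `|gradient Theta z| <= B -> - (B * `|h|) <= hdot (gradient Theta z) h.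
  move=> zB; apply: le_trans (hdot_ge _ _); rewrite lerN2.
  by rewrite ler_wpM2r.
have := gradient_le x y Tcvx Tdiff; have := bound _ (y - x) gxB.
have := gradient_le y x Tcvx Tdiff; have := bound _ (x - y) gyB.
have : B * `|x - y| < e by rewrite mulrC -ltr_pdivlMr.
rewrite (distrC y x) ltr_norml => *; apply/andP; split; lra.
Unshelve. all: by end_near. Qed.

Lemma relax_continuous : continuous N.
Proof.
apply: (@lipschitz_le_continuous _ _ _ _ 1) => z w.
by rewrite mul1r; exact: relax_nonexpansive.
Qed.

(** A point with zero residual is fixed by the relaxation, so it is a solution
as soon as its objective is not above the optimum; compactness turns this into
a uniform gap away from the solution set. *)
Lemma optimality_gap p rad delta : W p -> 0 < delta ->
  exists2 eta, 0 < eta & forall z, `|z - p| <= rad -> delta <= dist W z ->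
    eta <= `|G z| + Num.max 0 (Theta (N z) - Theta p).
Proof.
move=> [Tp pmin] d0.
pose C := [set z | `|z - p| <= rad] `&` [set z | delta <= dist W z].
have Cc : compact C.
  apply: (@finite_dim_compact _ _ _ (rad + `|p|)) => //.
    apply: closedI.
      apply: (closed_comp (f := fun z => `|z - p|) (D := [set x | x <= rad])).
        by move=> z _; exact: norm_sub_continuous.
      exact: closed_le.
    apply: (closed_comp (f := dist W) (D := [set x | delta <= x])).
      by move=> z _; exact: dist_continuous.
    exact: closed_ge.
  move=> z [/= zr _]; rewrite -(subrK p z).
  by apply: le_trans (ler_normD _ _) _; rewrite lerD2r.
have [||m m0 mP] := compact_pos_lower_bound
    (h := fun z => `|G z| + Num.max 0 (Theta (N z) - Theta p)) Cc.
- move=> z; apply: cvgD; first by apply: cvg_norm; exact: residual_continuous.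
  apply: (@continuous_max _ _ (cst 0) (fun z => Theta (N z) - Theta p) z).
    exact: cvg_cst.
  apply: cvgB; last exact: cvg_cst.
  apply: (@continuous_comp _ _ _ N Theta z); first exact: relax_continuous.
  exact: objective_continuous.
- move=> z [_ /= dz]; rewrite lt_neqAle addr_ge0 ?le_max ?lexx// andbT eq_sym.
  rewrite paddr_eq0 ?le_max ?lexx//; apply/negP => /andP[/eqP/normr0_eq0 Gz].
  move=> /eqP Tz; have Fz : Fix T z.
    by apply/esym/eqP; rewrite -subr_eq0; apply/eqP.
  have Nz : N z = z by rewrite /N relaxE -/(G z) Gz scaler0 subr0.
  have Wz : W z.
    split=> // y Fy; apply: le_trans (pmin y Fy); rewrite /= lee_fin -subr_le0.
    by rewrite -[X in Theta X - _]Nz -Tz le_max lexx orbT.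
  have := dist_le z Wz; rewrite subrr normr0; lra.
by exists m => // z zr zd; apply: mP.
Qed.

(** Either the residual or the objective gap is at least [eta / 2] away from
the solutions: the first gives a decrease by a constant, the second a decrease
proportional to the step size, and both dominate the remaining errors once the
step size is small. *)
Theorem hsdm_dist_cvg0 : dist W (z_ n) @[n --> \oo] --> 0.
Proof.
have [p Wp] := W0; have [Tp pmin] := Wp.
have [rad rad0 zrad] := iterates_bounded Tp.
have [a0 a1] := andP a01.
pose c := alpha * (1 - alpha).
have c0 : 0 < c by rewrite mulr_gt0// subr_gt0.
pose M := `|gradient Theta p|; have M0 : 0 <= M by rewrite /M.
pose V := M + k * rad; have V0 : 0 <= V by rewrite addr_ge0// mulr_ge0.
apply: (@divergent_descent_cvg0 _ _ (fun n => lambda n.+1)) => //.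
  by move=> n; exact: dist_ge0.
move=> delta d0; have [eta eta0 gap] := optimality_gap rad Wp d0.
exists (eta / 2); first by rewrite divr_gt0.
(* M * rad bounds the possible excess of the optimal value over the objective at
   the relaxed iterate, and V bounds the gradient there. *)
have D0 : 0 <= 2 * (M * rad) + V ^+ 2 + eta / 2.
  by rewrite !addr_ge0 ?sqr_ge0 ?mulr_ge0 ?invr_ge0// ltW.
have ce0 : 0 < c * (eta / 2) ^+ 2 by rewrite mulr_gt0 ?exprn_gt0 ?divr_gt0.
have eta2 : 0 < eta / 2 by rewrite divr_gt0.
have near1 := lambda_small D0 ce0.
have near2 := lambda_small (sqr_ge0 V) eta2.
have near3 := lambda_small V0 d0.
have near4 := lambda_small ler01 ltr01.
near=> n.
have s0 : `|z_ n - p| <= rad by near: n.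
have s1 : lambda n.+1 * (2 * (M * rad) + V ^+ 2 + eta / 2) <= c * (eta / 2) ^+ 2.
  by near: n.
have s2 : lambda n.+1 * V ^+ 2 <= eta / 2 by near: n.
have s3 : lambda n.+1 * V <= delta by near: n.
have s4 : lambda n.+1 * 1 <= 1 by near: n.
have ln := l0 n.
set w := N (z_ n) in s0 *.
have wp : `|w - p| <= rad by apply: le_trans (relax_le _ Tp) _.
pose v := gradient Theta w.
have vV : `|v| <= V.
  apply: le_trans (gradient_norm_le w p) _.
  by rewrite /V lerD2l ler_wpM2l.
split=> [large|]; last first.
  rewrite -lerBlDr; apply: le_dist => // q Wq.
  rewrite lerBlDr; apply: le_trans (dist_le _ Wq) _.
  rewrite zS -/w -/v addrAC; apply: le_trans (ler_normB _ _) _.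
  rewrite normrZ (ger0_norm ln); apply: lerD; first by apply: relax_le; case: Wq.
  by apply: le_trans s3; rewrite ler_wpM2l.
have l2V : lambda n.+1 ^+ 2 * `|v| ^+ 2 <= lambda n.+1 * (lambda n.+1 * V ^+ 2).
  by rewrite expr2 -mulrA !ler_wpM2l// ler_pXn2r ?nnegrE.
have decrease : dist W (z_ n.+1) ^+ 2 <= dist W (z_ n) ^+ 2
    + (- (c * `|G (z_ n)| ^+ 2) - 2 * lambda n.+1 * (Theta w - Theta p)
       + lambda n.+1 * (lambda n.+1 * V ^+ 2)).
  apply: sqr_dist_le => // q [Tq qmin]; rewrite step_sqnorm -/w -/v.
  have pq : Theta q <= Theta p by have := qmin p Tp; rewrite lee_fin.
  have gq := gradient_le w q Tcvx Tdiff; rewrite -/v in gq.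
  have hq : Theta w - Theta p <= hdot v (w - q).
    by move: gq; rewrite -(opprB w q) hdotNr; lra.
  have := ler_wpM2l ln hq; have := relax_fejer (z_ n) Tq; rewrite -/w.
  have := residual_monotone (z_ n) q.
  have -> : G q = 0 by rewrite /G Tq subrr.
  by rewrite subr0 => /(ler_wpM2l (ltW c0)); rewrite /c; lra.
have lowerw : - (M * rad) <= Theta w - Theta p.
  have := gradient_le p w Tcvx Tdiff; have := hdot_ge (gradient Theta p) (w - p).
  have : M * `|w - p| <= M * rad by rewrite ler_wpM2l.
  rewrite -/M; lra.
have lsq : lambda n.+1 * (lambda n.+1 * V ^+ 2) <= lambda n.+1 * V ^+ 2.
  by rewrite ler_piMl ?mulr_ge0 ?sqr_ge0// -[leLHS]mulr1.
have lsq' := ler_wpM2l ln s2.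
have Gsq := mulr_ge0 (ltW c0) (sqr_ge0 `|G (z_ n)|).
have [Gbig|Gsmall] := leP (eta / 2) `|G (z_ n)|.
  have cG : c * (eta / 2) ^+ 2 <= c * `|G (z_ n)| ^+ 2.
    by rewrite ler_pM2l// ler_pXn2r ?nnegrE ?(ltW eta2).
  have := ler_wpM2l ln lowerw; move: decrease s1 lsq cG; lra.
have Tbig : eta / 2 <= Theta w - Theta p.
  have := gap _ s0 large; rewrite -/w.
  by case: (leP 0 (Theta w - Theta p)); lra.
have := ler_wpM2l ln Tbig; move: decrease lsq' Gsq; lra.
Unshelve. all: by end_near. Qed.

End HybridSteepestDescent.

(** * Convergence of the primal iterates *)

Lemma gradient_fst (R : realType) (X Y : hilbertType R) (Psi : X -> R)
    (z : hprod X Y) : gateaux_differentiable Psi ->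
  gradient (fun w : hprod X Y => Psi w.1) z =
    ((gradient Psi z.1, 0) : hprod X Y).
Proof. by move=> dPsi; apply/gradient_eq/is_gradient_fst/gradientP. Qed.

(** A multiplier at a primal solution supplies the dual component of a fixed
point above it. *)
Lemma fixed_LAL_exists (R : realType) (X K : hilbertType R)
    (f : X -> \bar R) (g : K -> \bar R) (A : {linear X -> K}) (u : R)
    (e : seq K) (x : X) :
  Gamma0 f -> Gamma0 g -> continuous A -> 0 < u -> parseval_frame e ->
  sri [set y - w | y in dom g & w in [set A x | x in dom f]] 0 ->
  argmin setT (fun x => f x + g (A x))%E x ->
  exists nu, Fix (T_LAL f g A u) ((x, (A x, nu)) : hprod X (hprod K K)).
Proof.
move=> fG gG Ac u0 eP qual xmin.
have [eta [fx gx]] := multiplier_exists fG gG Ac eP qual xmin.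
exists (- (u^-1 *: eta)); apply/fixed_LAL => //; split=> //.
  have -> : u *: adjoint A (- (u^-1 *: eta)) = - adjoint A eta => //.
  apply: hdot_inj => h; rewrite hdotZr hdotNr -!adjointP// hdotNr hdotZr.
  by field; rewrite gt_eqF.
by rewrite scalerN opprK scalerA divff ?scale1r// gt_eqF.
Qed.

Theorem theorem21 (R : realType) (X K : hilbertType R)
    (f : X -> \bar R) (g : K -> \bar R) (A : {linear X -> K}) (u : R)
    (Psi : X -> R)
    (hf : Gamma0 f) (hg : Gamma0 g) (hA : continuous A)
    (Sp := argmin setT (fun x : X => f x + g (A x))%E)
    (hSp : Sp !=set0)
    (hqual : sri [set y - w | y in dom g & w in [set A x | x in dom f]] 0)
    (hu : 0 < u)
    (hnorm : opnorm (fun z : hprod X K => A z.1 - z.2) <= u^-1)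
    (hPsi : Gamma0 (EFin \o Psi)) (hdiff : gateaux_differentiable Psi)
    (hlip : exists k : R, k.-lipschitz (gradient Psi))
    (Omega := argmin Sp (EFin \o Psi))
    (hOmega : Omega !=set0)
    (alpha : R) (halpha : 0 < alpha < 1)
    (lambda : nat -> R)
    (hlambda : (ell_plus 2 `\` ell_plus 1) (fun n => lambda n.+1))
    (H := hprod X (hprod K K)) (T := T_LAL f g A u : H -> H)
    (Theta := (fun z : H => Psi z.1) : H -> R) :
  hsdm_applicable (relax alpha T) Theta /\
  forall (xs xh : nat -> X) (y nu : nat -> K),
    (forall n, (xh n, (y n.+1, nu n.+1)) =
       (1 - alpha) *: ((xs n, (y n, nu n)) : H) +
       alpha *: T (xs n, (y n, nu n))) ->
    (forall n, xs n.+1 = xh n - lambda n.+1 *: gradient Psi (xh n)) ->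
    hsdm_iteration (relax alpha T) Theta lambda
      (fun n => (xs n, (y n, nu n))) /\
    (finite_dim H -> bounded_set (Fix T) ->
      dist Omega (xs n) @[n --> \oo] --> 0).
Proof.
have TN : forall z w : H, `|T z - T w| <= `|z - w|.
  exact: LAL_nonexpansive.
have Tcvx : convex_efun (EFin \o Theta).
  by have [_ _ _ Pcvx] := hPsi; move=> z w t t01; exact: Pcvx.
have Tdiff : gateaux_differentiable Theta.
  move=> z; exists ((gradient Psi z.1, 0) : H).
  exact/is_gradient_fst/gradientP.
split.
  split=> //; apply/klipschitzP => z w; rewrite mul1r.
  exact: relax_nonexpansive.
move=> xs xh y nu zhalf xstep.
have iter : hsdm_iteration (relax alpha T) Theta lambda
    (fun n => (xs n, (y n, nu n)) : H).
  move=> n; rewrite /relax -zhalf gradient_fst//= xstep.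
  by congr (_, (_, _)) => /=; rewrite scaler0 subr0.
split=> // fdH Fbd.
have [e eP] := finite_dim_frame fdH.
have eK := parseval_frame_fst (parseval_frame_snd eP).
pose W := argmin (Fix T) (EFin \o Theta).
have FSp z : Fix T z -> Sp z.1 by exact: fixed_LAL_minimizer.
have [x0 [Sx0 x0min]] := hOmega.
have [nu0 F0] := fixed_LAL_exists hf hg hA hu eK hqual Sx0.
have W0 : W !=set0.
  by exists (x0, (A x0, nu0)); split=> // z /FSp; exact: x0min.
have WOmega z : W z -> Omega z.1.
  move=> [/FSp Sz zmin]; split=> // x Sx.
  by apply: le_trans (x0min x Sx); exact: (zmin _ F0).
have [k /klipschitzP kP] := hlip.
have kT (z w : H) :
    `|gradient Theta z - gradient Theta w| <= `|k| * `|z - w|.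
  rewrite !gradient_fst//.
  apply: (@le_trans _ _ `|gradient Psi z.1 - gradient Psi w.1|).
    rewrite -(@ler_pXn2r _ 2)// ?nnegrE// hprod_sqnormE /=.
    by rewrite subrr normr0 expr0n addr0.
  apply: le_trans (kP _ _) _; apply: (@le_trans _ _ (`|k| * `|z.1 - w.1|)).
    by rewrite ler_wpM2r// ler_norm.
  by rewrite ler_wpM2l//; exact: (hprod_norm_fst (z - w)).
have [[l0 l2] l1] := hlambda.
have {}l1 : ~ cvgn (series (fun n => lambda n.+1)) by move=> cl; apply: l1.
have dW := hsdm_dist_cvg0 fdH TN Fbd halpha Tcvx Tdiff (normr_ge0 k) kT
  l0 l2 l1 W0 iter.
apply: (squeeze_cvgr _ (cvg_cst 0) dW); near=> n.
rewrite dist_ge0 /=; apply: le_dist => // p /WOmega Op.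
apply: le_trans (dist_le _ Op) _.
exact: (hprod_norm_fst (((xs n, (y n, nu n)) : H) - p)).
Unshelve. all: by end_near. Qed.
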